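(* Let $(X,d,\nu)$ be a compact metric space endowed with a probability measure and let $G$ be a countable group acting ergodically and quasi-invariantly on $(X,\nu)$. Suppose $\Upsilon_n$, $n\in\mathbb N$, is a family of functions admissible relative to $\Omega(n,m)$, $n,m\in\mathbb N$, for $G\curvearrowright(X,\nu)$. For each $n,m$ let $\zeta_{n,m}$ be the measure on $\mathbb R$ given by $$\zeta_{n,m}(E)=\sum_{g\in G}\int\int 1_E\big(R(g^{-1},b')-R(g^{-1},b)\big)1_{\Omega(n,m)}(b)\Upsilon_n(g,b,b')\,d\nu(b)\,d\nu(b').$$ For each $m$ let $\zeta_m$ be any weak-* (subsequential) limit of the $\zeta_{n,m}$ as $n\to\infty$, and let $\zeta$ be any weak-* (subsequential) limit of the $\zeta_m$ as $m\to\infty$. Then $e^T$ is contained in the stable ratio set of $G\curvearrowright(X,\nu)$ for every $T$ in the support of $\zeta$.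
   Context: Write $(\nu\circ g)(A)=\nu(gA)$ and $R(g,\eta)=\log\frac{d\nu\circ g}{d\nu}(\eta)$. **Relatively admissible family.** A family of measurable functions $\Upsilon_n:G\times X\times X\to[0,\infty)$, $n\in\mathbb N$, is admissible relative to a family of closed subsets $\Omega(n,m)\subset X$ ($n,m\in\mathbb N$) if: (1) There are $D(m)>0$ with $\lim_{m\to\infty}D(m)=0$ such that $\nu(\Omega(n,m))>1-D(m)$ for all $n,m\in\mathbb N$. (2) For each $m$ there is $f_m:\mathbb N\to\mathbb R$ with $f_m(n)\to0$ as $n\to\infty$ such that for all $(g,b,b')$ with $b\in\Omega(n,m)$ and $\Upsilon_n(g,b,b')>0$ we have $d(b,b')<f_m(n)$ and $d(g^{-1}b,g^{-1}b')<f_m(n)$. (3) For each $m$ there are constants $C(m)>0$, $N(m)>0$ such that if $n>N(m)$ then $|R(g^{-1},b)|+|R(g^{-1},b')|<C(m)$ and $|R(g^{-1},b)-R(g^{-1},b')|\ge 1/C(m)$ for a.e. $(g,b,b')$ with $b\in\Omega(n,m)$ and $\Upsilon_n(g,b,b')>0$. (4) $\sum_{g\in G}\int\Upsilon_n(g,b,b')\,d\nu(b')=1$ for every $n>0$ and $b\in X$. (5) There are constants $C(m)>0$ such that the following three quantities are bounded above by $C(m)$ for all $n>N(m)$: $\int_{b\in\Omega(n,m)}\sum_{g\in G}\Upsilon_n(g,b,b')\,d\nu(b)$ for a.e. $b'\in X$; $\int_{b\in\Omega(n,m)}\sum_{g\in G}\Upsilon_n(g,b,gb')\frac{d\nu\circ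 g}{d\nu}(b')\,d\nu(b)$ for a.e. $b'\in X$; $\int\sum_{g\in G}1_{\Omega(n,m)}(gb)\Upsilon_n(g,gb,b')\frac{d\nu\circ g}{d\nu}(b)\,d\nu(b')$ for a.e. $b\in X$. **Ratio set.** For a quasi-invariant action of $G$ on a probability space $(X,\nu)$, a real number $r$ is in the ratio set $RS(G\curvearrowright(X,\nu))$ if for every positive measure set $A\subset X$ and every $\epsilon>0$ there are a positive measure subset $A'\subset A$ and a nonidentity $g\in G$ with $gA'\subset A$ and $|\frac{d\nu\circ g}{d\nu}(b)-r|\le\epsilon$ for all $b\in A'$. **Stable ratio set.** $r$ is in the stable ratio set $SRS(G\curvearrowright(X,\nu))$ if $r\in RS(G\curvearrowright(X\times Y,\nu\times\kappa))$ (product action) for every probability measure preserving action $G\curvearrowright(Y,\kappa)$. *)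

(* Defs.v *)
From HB Require Import structures.
From mathcomp Require Import all_boot all_order all_algebra.
From mathcomp Require Import all_classical all_reals all_analysis measurable_realfun.

Set Implicit Arguments.
Unset Strict Implicit.
Unset Printing Implicit Defensive.
Import Order.TTheory GRing.Theory Num.Theory.
Import numFieldNormedType.Exports.
Local Open Scope classical_set_scope.
Local Open Scope charge_scope.
Local Open Scope ring_scope.


(* A metric space that also carries a sigma-algebra.  Nothing relates the two
   structures here: that the sigma-algebra is the Borel one is a separate
   hypothesis, [is_borel]. *)
#[short(type="measurableMetricType")]
HB.structure Definition MeasurableMetric (R : numDomainType)
    (d : measure_display) := {T of Metric R T & Measurable d T}.

Definition is_borel (R : realType) d (X : measurableMetricType R d) :=
  @measurable d X = <<s @open X >>.

Record measurable_action (G : groupType) d (X : measurableType d) := {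
  act :> G -> X -> X ;
  act1 : forall x, act 1%g x = x ;
  actM : forall g h x, act (g * h)%g x = act g (act h x) ;
  measurable_act : forall g, measurable_fun [set: X] (act g) }.

Section measurable_action.
Context (G : groupType) d (X : measurableType d) (a : measurable_action G X).

Lemma actK g : cancel (a g) (a (g^-1)%g).
Proof. by move=> x; rewrite -actM mulVg act1. Qed.

Lemma actVK g : cancel (a (g^-1)%g) (a g).
Proof. by move=> x; rewrite -actM mulgV act1. Qed.

HB.instance Definition _ g :=
  isMeasurableFun.Build _ _ _ _ (a g) (measurable_act a g).

Lemma image_actE g (A : set X) : a g @` A = a (g^-1)%g @^-1` A.
Proof.
apply/seteqP; split=> [_ [x Ax <-]|x Ax] /=; first by rewrite actK.
by exists (a (g^-1)%g x) => //; rewrite actVK.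
Qed.

End measurable_action.

Section product_action.
Context (G : groupType) d (X : measurableType d) d' (Y : measurableType d').
Variables (a : measurable_action G X) (b : measurable_action G Y).

Let pact g (p : X * Y) : X * Y := (a g p.1, b g p.2).

Let pact1 p : pact 1%g p = p.
Proof. by case: p => x y; rewrite /pact /= !act1. Qed.

Let pactM g h p : pact (g * h)%g p = pact g (pact h p).
Proof. by rewrite /pact /= !actM. Qed.

Let measurable_pact g : measurable_fun [set: X * Y] (pact g).
Proof.
by apply: measurable_fun_pair; apply: measurableT_comp => //;
  exact: measurable_act.
Qed.

Definition product_action : measurable_action G (X * Y)%type :=
  {| act := pact ; act1 := pact1 ; actM := pactM ;
     measurable_act := measurable_pact |}.

End product_action.

Section translate.
Context (R : realType) (G : groupType) d (X : measurableType d).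
Variables (a : measurable_action G X) (nu : probability X R) (g : G).

(* nu \o g *)
Definition translate (A : set X) : \bar R := nu (a g @` A).

Let translateE : translate = distribution nu (a (g^-1)%g).
Proof. by apply/funext => A; rewrite /translate image_actE. Qed.

Let translate0 : translate set0 = 0%E.
Proof. by rewrite translateE measure0. Qed.

Let translate_ge0 A : (0 <= translate A)%E.
Proof. exact: measure_ge0. Qed.

Let translate_sigma_additive : semi_sigma_additive translate.
Proof. by rewrite translateE; exact: measure_semi_sigma_additive. Qed.

HB.instance Definition _ := isMeasure.Build _ _ _ translate
  translate0 translate_ge0 translate_sigma_additive.

Let translate_setT : translate [set: X] = 1%E.
Proof. by rewrite translateE probability_setT. Qed.

HB.instance Definition _ := Measure_isProbability.Build _ _ _ translate
  translate_setT.

End translate.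

Section quasi_invariant_action.
Context (R : realType) (G : groupType) d (X : measurableType d).
Variables (a : measurable_action G X) (nu : probability X R).

Definition quasi_invariant := forall g (A : set X), measurable A ->
  nu (a g @` A) = 0%E <-> nu A = 0%E.

Definition measure_preserving := forall g (A : set X), measurable A ->
  nu (a g @` A) = nu A.

Definition ergodic := forall A : set X, measurable A ->
  (forall g, a g @` A = A) -> nu A = 0%E \/ nu A = 1%E.

(* d(nu \o g)/d nu, for the version chosen by the library.  It is meaningful
   only if nu \o g is absolutely continuous with respect to nu.  On a null set
   that version may be nonpositive, where [ln] is 0; every use below is
   insensitive to null sets. *)
Definition RN (g : G) (x : X) : R :=
  fine (('d (charge_of_finite_measure (translate a nu g)) '/d nu) x).

Definition logRN (g : G) (x : X) : R := ln (RN g x).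

Lemma measurable_logRN g : measurable_fun [set: X] (logRN g).
Proof.
apply: measurableT_comp; first exact: measurable_ln.
rewrite /RN; apply: measurableT_comp => //.
have [num|num] := pselect (charge_of_finite_measure (translate a nu g) `<< nu).
  exact: measurable_int (Radon_Nikodym_integrable num).
by rewrite /Radon_Nikodym; case: pselect => // _; exact: measurable_cst.
Qed.

Definition ratio_set : set R := [set r | forall A : set X,
  measurable A -> (0 < nu A)%E -> forall eps : R, 0 < eps ->
  exists (A' : set X) (g : G), [/\ measurable A', A' `<=` A, (0 < nu A')%E,
    g != 1%g & a g @` A' `<=` A /\
    forall b, A' b -> `|RN g b - r| <= eps]].

End quasi_invariant_action.

Definition stable_ratio_set (R : realType) (G : groupType) d
    (X : measurableType d) (a : measurable_action G X) (nu : probability X R) :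
    set R :=
  [set r | forall d' (Y : measurableType d') (b : measurable_action G Y)
      (kappa : probability Y R), measure_preserving b kappa ->
    ratio_set (product_action a b) (nu \x kappa)%E r].

(* Measurable functions G * X * X -> [0, +oo[, where G is discrete. *)
Record transfer_function (R : realType) (G : groupType) d
    (X : measurableType d) := {
  transfer :> G -> X -> X -> R ;
  transfer_ge0 : forall g b b', 0 <= transfer g b b' ;
  measurable_transfer : forall g,
    measurable_fun [set: X * X] (fun p => transfer g p.1 p.2) }.

Section relatively_admissible.
Context (R : realType) (G : groupType) d (X : measurableMetricType R d).
Variables (a : measurable_action G X) (nu : probability X R).
Variables (Upsilon : nat -> transfer_function R G X).
Variables (Omega : nat -> nat -> set X).

Local Notation rn := (RN a nu).
Local Notation logrn := (logRN a nu).

Definition adm_large := exists D : nat -> R,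
  [/\ forall m, 0 < D m, D @ \oo --> (0 : R) &
      forall n m, ((1 - D m)%:E < nu (Omega n m))%E].

Definition adm_close := forall m, exists2 f : nat -> R, f @ \oo --> (0 : R) &
  forall n g b b', Omega n m b -> 0 < Upsilon n g b b' ->
    mdist b b' < f n /\ mdist (a (g^-1)%g b) (a (g^-1)%g b') < f n.

(* "For a.e. (g, b, b')" is for the product of the counting measure of the
   countable group G with nu \x nu, i.e., for every g and a.e. (b, b'). *)
Definition adm_ratio (N : nat -> nat) := forall m, exists2 C : R, 0 < C &
  forall n, (N m < n)%N -> forall g,
  {ae (nu \x nu)%E, forall p : X * X,
    Omega n m p.1 -> 0 < Upsilon n g p.1 p.2 ->
    `|logrn (g^-1)%g p.1| + `|logrn (g^-1)%g p.2| < C /\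
    C^-1 <= `|logrn (g^-1)%g p.1 - logrn (g^-1)%g p.2| }.

Definition adm_normalized := forall n b, (0 < n)%N ->
  (\esum_(g in [set: G]) \int[nu]_b' (Upsilon n g b b')%:E = 1)%E.

Definition adm_bounded (N : nat -> nat) := forall m, exists2 C : R, 0 < C &
  forall n, (N m < n)%N ->
  [/\ {ae nu, forall b', (\int[nu]_(b in Omega n m)
        (\esum_(g in [set: G]) (Upsilon n g b b')%:E) <= C%:E)%E},
      {ae nu, forall b', (\int[nu]_(b in Omega n m)
        (\esum_(g in [set: G]) (Upsilon n g b (a g b') * rn g b')%:E)
          <= C%:E)%E} &
      {ae nu, forall b, (\int[nu]_b'
        (\esum_(g in [set: G])
          (\1_(Omega n m) (a g b) * Upsilon n g (a g b) b' * rn g b)%:E)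
          <= C%:E)%E}].

Definition relatively_admissible :=
  [/\ forall n m, closed (Omega n m),
      adm_large, adm_close, adm_normalized &
      exists2 N : nat -> nat, forall m, (0 < N m)%N &
        adm_ratio N /\ adm_bounded N].

End relatively_admissible.

Section zeta.
Context (R : realType) (G : groupType) d (X : measurableType d).
Variables (a : measurable_action G X) (nu : probability X R).
Variables (O : set X) (U : transfer_function R G X).

Local Notation logrn := (logRN a nu).

Definition zeta (E : set R) : \bar R :=
  (\esum_(g in [set: G]) \int[nu]_b' \int[nu]_b
    (\1_E (logrn (g^-1)%g b' - logrn (g^-1)%g b) * \1_O b * U g b b')%:E)%E.

Hypothesis mO : measurable O.

Let h g (E : set R) (p : X * X) : \bar R :=
  (\1_E (logrn (g^-1)%g p.2 - logrn (g^-1)%g p.1) * \1_O p.1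
     * U g p.1 p.2)%:E.

Let h_ge0 g E p : (0 <= h g E p)%E.
Proof.
by rewrite lee_fin mulr_ge0 ?transfer_ge0// mulr_ge0// indicE ler0n.
Qed.

Let measurable_h g E : measurable E -> measurable_fun [set: X * X] (h g E).
Proof.
move=> mE; apply/measurable_EFinP; apply: measurable_funM; last first.
  exact: measurable_transfer.
apply: measurable_funM.
  apply: (@measurableT_comp _ _ _ _ _ _ (\1_E : R -> R)).
    exact: measurable_indic.
  by apply: measurable_funB; apply: measurableT_comp => //;
    exact: measurable_logRN.
by apply: (@measurableT_comp _ _ _ _ _ _ (\1_O : X -> R)).
Qed.

Let zetaE E : zeta E = \esum_(g in [set: G])
  (\int[nu]_y fubini_G nu (h g E) y)%E.
Proof. by []. Qed.

Let zeta0 : zeta set0 = 0%E.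
Proof.
rewrite /zeta; apply: esum1 => g _; apply: integral0_eq => y _.
by apply: integral0_eq => x _; rewrite indic0 !mul0r.
Qed.

Let zeta_ge0 E : (0 <= zeta E)%E.
Proof.
apply: esum_ge0 => g _; apply: integral_ge0 => y _.
by apply: integral_ge0 => x _; exact: (h_ge0 g E (x, y)).
Qed.

Let h_bigcup g (F : (set R)^nat) p : (forall i, measurable (F i)) ->
  trivIset setT F -> (h g (\bigcup_i F i) p = \sum_(i <oo) h g (F i) p)%E.
Proof.
move=> mF tF; rewrite /h; set t := _ - _; set c := \1_O _.
under eq_eseriesr do rewrite -mulrA mulrC EFinM.
rewrite nneseriesZl; last by move=> i _; rewrite lee_fin indicE ler0n.
rewrite -mulrA mulrC EFinM; congr (_ * _)%E.
have := @measure_bigcup _ _ _ (\d_t : {measure set R -> \bar R}) setT F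
  (fun i _ => mF i) tF.
rewrite /= diracE indicE => ->.
rewrite eseries_mkcond; apply: eq_eseriesr => i _.
by rewrite in_setT diracE indicE.
Qed.

Let zeta_sigma_additive : semi_sigma_additive zeta.
Proof.
move=> F mF tF mUF.
have -> : zeta (\bigcup_i F i) = (\sum_(i <oo) zeta (F i))%E.
  rewrite zetaE nneseries_esumT//.
  transitivity (\esum_(g in [set: G]) \esum_(i in [set: nat])
      (\int[nu]_y fubini_G nu (h g (F i)) y)%E).
    apply: eq_esum => g _; rewrite -nneseries_esumT; last first.
      by move=> i; apply: integral_ge0 => y _; exact: integral_ge0.
    rewrite -integral_nneseries//.
    - apply: eq_integral => y _; rewrite /fubini_G -integral_nneseries//.
      + by apply: eq_integral => x _; exact: h_bigcup.
      + move=> i; apply: measurableT_comp (measurable_h g (mF i)) _.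
        exact: measurable_pair2.
    - by move=> i; apply: measurable_fun_fubini_tonelli_G => //;
        exact: measurable_h.
    - by move=> i y _; exact: integral_ge0.
  rewrite (@esum_esum _ _ _ setT (fun=> setT)); last first.
    by move=> g i _ _; apply: integral_ge0 => y _; exact: integral_ge0.
  rewrite (@esum_esum _ _ _ setT (fun=> setT)); last first.
    move=> i g _ _; apply: integral_ge0 => y _; apply: integral_ge0 => x _.
    exact: (h_ge0 g (F i) (x, y)).
  rewrite (reindex_esum ([set: nat] `*`` (fun=> [set: G])) _
    (fun p => (p.2, p.1)))//.
  split=> //= [[i g] [j k] _ _ /= [-> ->]//|[g i] _].
  by exists (i, g).
exact: is_cvg_ereal_nneg_natsum.
Qed.

HB.instance Definition _ := isMeasure.Build _ _ _ zeta
  zeta0 zeta_ge0 zeta_sigma_additive.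

End zeta.

(* Convergence against C_c(R).  For measures of uniformly bounded mass, such as
   [zeta], it is the same as convergence against C_0(R). *)
Definition weak_star_cvg (R : realType) (mu_ : nat -> set R -> \bar R)
    (mu : set R -> \bar R) :=
  forall f : R -> R, continuous f -> compact (closure [set x | f x != 0]) ->
    (fun n => \int[mu_ n]_x (f x)%:E)%E @ \oo --> (\int[mu]_x (f x)%:E)%E.

Definition weak_star_subseq_limit (R : realType)
    (mu_ : nat -> set R -> \bar R) (mu : set R -> \bar R) :=
  exists2 phi : nat -> nat, {homo phi : i j / (i < j)%N} &
    weak_star_cvg (mu_ \o phi) mu.

Definition measure_support (R : realType) (mu : set R -> \bar R) : set R :=
  [set x | forall V : set R, open V -> V x -> (0 < mu V)%E].

(* Main.v *)
(** Fix a measure preserving action on [Y], a set [A] of positive measure in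
    [X * Y] to which no nontrivial group element returns with Radon-Nikodym
    cocycle near [T], and let [B_J] be the set of points sent into [A] by some
    group element with cocycle in [J].  If [Upsilon_n g b b' > 0] and the
    difference [Delta] of the cocycles of [g^-1] at [b'] and [b] is near [T],
    one can travel from [b] to [g^-1 b], jump to the nearby point [g^-1 b'],
    travel to [b'] and jump back to [b]; this changes the cocycle of a hit of
    [A] by [Delta], which is excluded, unless one of the jumps leaves the fiber
    of some [B_J] (finitely many short intervals [J] suffice).  Fibers of a
    measurable set are, up to a small integrable error [e], continuous in
    measure, so the fiber over [b] of the union of the [B_J] has measure at most
    [e b + e b' + e (g^-1 b) + e (g^-1 b')].  The bounds of admissibility
    control the [Upsilon_n]-average of this by a multiple of the integral of
    [e], while by ergodicity the fibers have measure bounded below off a small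
    set of [b].  Hence [zeta_{n,m}] gives small mass to a neighborhood of [T],
    contradicting that [T] is in the support of the limit. *)

Require Import Defs.
From HB Require Import structures.
From mathcomp Require Import all_boot all_order all_algebra.
From mathcomp Require Import all_classical all_reals all_analysis.
From mathcomp Require Import measurable_realfun.
From mathcomp Require Import ring lra.

Set Implicit Arguments.
Unset Strict Implicit.
Unset Printing Implicit Defensive.
Import Order.TTheory GRing.Theory Num.Theory.
Import numFieldNormedType.Exports.
Local Open Scope classical_set_scope.
Local Open Scope ring_scope.

(** * The Radon-Nikodym cocycle *)

Section radon_nikodym_cocycle.
Context (R : realType) (G : groupType) d (X : measurableType d).
Variables (a : measurable_action G X) (nu : probability X R).
Local Open Scope ereal_scope.

Lemma integral_translate g (f : X -> \bar R) : measurable_fun setT f ->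
  (forall x, 0 <= f x) ->
  \int[translate a nu g]_x f x = \int[nu]_x f (a (g^-1)%g x).
Proof.
move=> mf f0; transitivity (\int[distribution nu (a (g^-1)%g)]_x f x).
  by apply: eq_measure_integral => A mA _; rewrite /= /translate image_actE.
by rewrite ge0_integral_distribution.
Qed.

Hypothesis qi : quasi_invariant a nu.

Lemma translate_dominated g : translate a nu g `<< nu.
Proof.
apply/null_content_dominatesP => A mA A0; exact/(qi g mA).
Qed.

Let rn g := Radon_Nikodym_SigmaFinite.f (translate a nu g) nu.

Let measurable_rn g : measurable_fun setT (rn g).
Proof.
apply: measurable_int (Radon_Nikodym_SigmaFinite.f_integrable _).
exact: translate_dominated.
Qed.

Let RN_ae_rn g : {ae nu, forall x, (RN a nu g x)%:E = rn g x}.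
Proof.
have := ae_eq_Radon_Nikodym_SigmaFinite (translate_dominated g) measurableT.
apply: filterS => x /= /(_ I) rnE; rewrite /RN fineK; first exact/esym/rnE.
apply: Radon_Nikodym_fin_num; exact: translate_dominated.
Qed.

Lemma measurable_RN g : measurable_fun setT (RN a nu g).
Proof.
apply: measurableT_comp => //.
apply: measurable_int (Radon_Nikodym_integrable _).
exact: translate_dominated.
Qed.

(** The set [Z] where the derivative is at most 0 satisfies [nu (g Z) = 0], since [nu (g Z)] is the
    integral of the derivative over [Z]. Quasi-invariance then gives [nu Z = 0]. *)
Lemma RN_gt0 g : {ae nu, forall x, (0 < RN a nu g x)%R}.
Proof.
pose Z := [set x | (RN a nu g x <= 0)%R].
have mZ : measurable Z.
  by rewrite -[Z]setTI; apply: measurable_fun_le => //; exact: measurable_RN.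
exists Z; split => //; last by move=> x /= /negP; rewrite -leNgt.
apply/(qi g mZ).
have -> : nu (a g @` Z) = \int[nu]_(x in Z) rn g x.
  by rewrite -(Radon_Nikodym_SigmaFinite.f_integral (translate_dominated g)).
apply/eqP; rewrite eq_le integral_ge0 ?andbT; last first.
  move=> x _; apply: Radon_Nikodym_SigmaFinite.f_ge0.
  exact: translate_dominated.
rewrite -(@integral0 _ _ _ nu Z); apply: ae_ge0_le_integral => //.
- move=> x _; apply: Radon_Nikodym_SigmaFinite.f_ge0.
  exact: translate_dominated.
- exact: measurable_funTS.
- by have := RN_ae_rn g; apply: filterS => x <- Zx; rewrite lee_fin.
Qed.

(** The integrand on the left is [f' \o a (g^-1)], so its integral is that of [f'] against
    [translate a nu g]. *)
Lemma RN_change_of_variables g (f : X -> \bar R) : measurable_fun setT f ->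
  (forall x, 0 <= f x) ->
  \int[nu]_x f x = \int[nu]_x (f (a g x) * (RN a nu g x)%:E).
Proof.
move=> mf f0; pose f' x := f (a g x).
have mf' : measurable_fun setT f' by apply: measurableT_comp.
transitivity (\int[nu]_x f' (a (g^-1)%g x)).
  by apply: eq_integral => x _; rewrite /f' actVK.
have f'0 x : 0 <= f' x by exact: f0.
rewrite -integral_translate//.
rewrite -(Radon_Nikodym_SigmaFinite.change_of_variables
  (translate_dominated g) f'0 measurableT mf').
apply: ae_eq_integral => //.
- by apply: emeasurable_funM => //; exact: measurable_rn.
- by apply: emeasurable_funM => //; apply/measurable_EFinP/measurable_RN.
- by have := RN_ae_rn g; apply: filterS => x /= -> _.
Qed.

Lemma RN_unique g (h : X -> \bar R) : measurable_fun setT h ->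
  (forall x, 0 <= h x) ->
  (forall A, measurable A -> nu (a g @` A) = \int[nu]_(x in A) h x) ->
  {ae nu, forall x, (RN a nu g x)%:E = h x}.
Proof.
move=> mh h0 hE.
have : ae_eq nu setT (rn g) h.
  apply: integral_ae_eq => //.
    exact: Radon_Nikodym_SigmaFinite.f_integrable (translate_dominated g).
  move=> E _ mE.
  by rewrite -hE// -(Radon_Nikodym_SigmaFinite.f_integral
    (translate_dominated g)).
by have := RN_ae_rn g; apply: filterS2 => x -> /(_ I).
Qed.

(** [RN] may be negative on a null set. Truncating at 0 gives a version that is nonnegative
    everywhere, as [RN_unique] and nonnegative integration require. *)
Let rnp g x := (Num.max 0 (RN a nu g x))%:E.

Let rnp_ge0 g x : 0 <= rnp g x.
Proof. by rewrite lee_fin le_max lexx. Qed.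

Let measurable_rnp g : measurable_fun setT (rnp g).
Proof.
by apply/measurable_EFinP/measurable_maxr => //; exact: measurable_RN.
Qed.

Let RN_ae_rnp g : {ae nu, forall x, (RN a nu g x)%:E = rnp g x}.
Proof.
have := RN_gt0 g; apply: filterS => x /ltW RN0.
by rewrite /rnp; congr EFin; rewrite max_r.
Qed.

Let translate_rnp g A : measurable A ->
  nu (a g @` A) = \int[nu]_(x in A) rnp g x.
Proof.
move=> mA; transitivity (\int[nu]_(x in A) rn g x).
  by rewrite -(Radon_Nikodym_SigmaFinite.f_integral (translate_dominated g)).
apply: ae_eq_integral => //.
- exact/measurable_funTS/measurable_rn.
- exact/measurable_funTS/measurable_rnp.
have := RN_ae_rn g; have := RN_ae_rnp g.
by apply: filterS2 => x -> ->.
Qed.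

(** Both sides are densities of [A |-> nu (g h A)]: integrate the derivative of [g] over [h A], then
    change variables by [h]. *)
Lemma RN_cocycle g h : {ae nu, forall x,
  RN a nu (g * h)%g x = (RN a nu g (a h x) * RN a nu h x)%R}.
Proof.
have H : {ae nu, forall x, (RN a nu (g * h)%g x)%:E =
   rnp g (a h x) * rnp h x}.
  have mgh : measurable_fun setT (rnp g \o a h).
    by apply: measurableT_comp => //; exact: measurable_rnp.
  apply: RN_unique.
  - by apply: emeasurable_funM => //; exact: measurable_rnp.
  - by move=> x; rewrite mule_ge0.
  - move=> A mA; have mhA : measurable (a h @` A).
      by rewrite image_actE -[X in measurable X]setTI; exact: measurable_act.
    have -> : a (g * h)%g @` A = a g @` (a h @` A).
      by rewrite image_comp; apply: eq_imagel => x _; rewrite actM.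
    rewrite translate_rnp// integral_mkcond (RN_change_of_variables h);
      last 2 first.
    + exact/(measurable_restrictT _ _).1/measurable_funTS/measurable_rnp.
    + by move=> x; apply: erestrict_ge0 => y _.
    rewrite [RHS]integral_mkcond; apply: ae_eq_integral => //.
    + apply: emeasurable_funM; last exact/measurable_EFinP/measurable_RN.
      apply: measurableT_comp => //.
      exact/(measurable_restrictT _ _).1/measurable_funTS/measurable_rnp.
    + apply/(measurable_restrictT _ _).1/measurable_funTS => //.
      by apply: emeasurable_funM => //; exact: measurable_rnp.
    + have := RN_ae_rnp h; apply: filterS => x /= -> _.
      rewrite /patch; have -> : (a h x \in a h @` A) = (x \in A).
        apply/idP/idP; rewrite !inE; last by exists x.
        by move=> -[y Ay /(can_inj (actK a h)) <-].
      by case: ifP => _; rewrite ?mul0e.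
(* The derivative of [g] is evaluated at [h x], so its exceptional null set is pulled back by [h];
   quasi-invariance keeps it null. *)
have H2 : {ae nu, forall x, (RN a nu g (a h x))%:E = rnp g (a h x)}.
  have [N [mN N0 sN]] := RN_ae_rnp g.
  have ahN : a h @` (a h @^-1` N) = N.
    by apply/seteqP; split=> [_ [x Nx <-]//|x Nx]; exists (a (h^-1)%g x);
      rewrite /= actVK.
  exists (a h @^-1` N); split => //.
  + by rewrite -[X in measurable X]setTI; exact: measurable_act.
  + apply/(qi h); last by rewrite ahN.
    by rewrite -[X in measurable X]setTI; exact: measurable_act.
  + by move=> x /= /sN.
have := RN_ae_rnp h; apply: filterS3 H H2 => x /= H H2 H3; apply: EFin_inj.
by rewrite H -H2 -H3.
Qed.

End radon_nikodym_cocycle.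

(** * Continuity in measure of the fibers of a measurable set *)

Lemma vanishing_measure_small (R : realType) d (T : measurableType d)
    (mu : probability T R) (F : (set T)^nat) : (forall n, measurable (F n)) ->
  nonincreasing_seq F -> mu (\bigcap_n F n) = 0%E ->
  forall eta : R, 0 < eta -> exists n, (mu (F n) < eta%:E)%E.
Proof.
move=> mF ndF F0 eta eta0.
have : mu \o F @ \oo --> mu (\bigcap_n F n).
  apply: nonincreasing_cvg_mu => //; last exact: bigcapT_measurable.
  by rewrite (le_lt_trans (probability_le1 _ _))// ltry.
rewrite F0 => /fine_cvgP[_] /cvgrPdist_lt /(_ _ eta0) [n _ /(_ n)].
move=> /(_ (leqnn _)); rewrite sub0r normrN /= => H; exists n.
have fin : mu (F n) \is a fin_num by apply: fin_num_measure.
by rewrite -(fineK fin) lte_fin; apply: le_lt_trans H; rewrite ler_norm.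
Qed.

Lemma borel_open_measurable (R : realType) d (X : measurableMetricType R d)
  (U : set X) : is_borel X -> open U -> measurable U.
Proof.
move=> borelX oU; have : (<<s @open X >>) U by exact: sub_sigma_algebra.
by rewrite -borelX.
Qed.

Section section_approximation.
Context (R : realType) d (X : measurableMetricType R d) d'
  (Y : measurableType d').
Variables (nu : probability X R) (kappa : probability Y R).
Hypothesis borelX : is_borel X.

(* The map [x |-> xsection S x], into the sets modulo null sets, is close in
   measure to a uniformly continuous one. *)
Definition section_approx (S : set (X * Y)) := forall eta : R, 0 < eta ->
  exists2 del : R, 0 < del & exists e : X -> \bar R,
  [/\ measurable_fun setT e, forall x, (0 <= e x)%E,
      (\int[nu]_x e x <= eta%:E)%E &
      forall x x', mdist x x' < del ->
        (kappa (xsection S x `\` xsection S x') <= e x + e x')%E].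

Let msec (S : set (X * Y)) x : measurable S -> measurable (xsection S x).
Proof. exact: measurable_xsection. Qed.

(** Error functions add up, each new set receiving half of the remaining [eta]. This serves the
    finite part of a countable union, and later the finitely many sets of hits. *)
Lemma section_approxN (S : nat -> set (X * Y)) n :
  (forall i, measurable (S i)) -> (forall i, section_approx (S i)) ->
  forall eta : R, 0 < eta ->
  exists2 del : R, 0 < del & exists e : X -> \bar R,
  [/\ measurable_fun setT e, forall x, (0 <= e x)%E,
      (\int[nu]_x e x <= eta%:E)%E &
      forall x x', mdist x x' < del ->
        (\sum_(i < n) kappa (xsection (S i) x `\` xsection (S i) x')
          <= e x + e x')%E].
Proof.
move=> mS aS; elim: n => [|n IHn] eta eta0.
  exists 1 => //; exists (cst 0%E); split => //.
    by rewrite integral0 lee_fin ltW.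
  by move=> x x' _; rewrite big_ord0 adde0.
have eta20 : 0 < eta / 2 by rewrite divr_gt0.
have [d1 d10 [e1 [me1 e10 ie1 He1]]] := IHn _ eta20.
have [d2 d20 [e2 [me2 e20 ie2 He2]]] := aS n _ eta20.
exists (Num.min d1 d2); first by rewrite lt_min d10.
exists (fun x => e1 x + e2 x)%E; split.
- exact: emeasurable_funD.
- by move=> x; rewrite adde_ge0.
- by rewrite ge0_integralD// (splitr eta) EFinD leeD.
- move=> x x'; rewrite lt_min => /andP[/He1 H1 /He2 H2].
  by rewrite big_ord_recr/= addeACA leeD.
Qed.

(** Complementation exchanges the roles of [x] and [x'], and the bound is symmetric in them. *)
Lemma section_approxC S : section_approx S -> section_approx (~` S).
Proof.
move=> aS eta /aS[del del0 [e [me e0 ie He]]]; exists del => //.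
exists e; split => // x x' xx'; rewrite addeC.
have -> : xsection (~` S) x `\` xsection (~` S) x' =
    xsection S x' `\` xsection S x.
  apply/seteqP; split=> y /= []; rewrite /xsection /= !inE /= => ? ?.
    by split=> //; apply: contrapT => ?.
  by split=> //; exact.
by apply: He; rewrite metric_sym.
Qed.

(** A finite union is handled by [section_approxN]. The remainder [F n] has small product measure,
    which is the integral of its fiber measures, so these are added to the error function. *)
Lemma section_approx_bigcup (S : nat -> set (X * Y)) :
  (forall i, measurable (S i)) -> (forall i, section_approx (S i)) ->
  section_approx (\bigcup_i S i).
Proof.
move=> mS aS eta eta0.
have eta20 : 0 < eta / 2 by rewrite divr_gt0.
pose F n := \bigcup_i S i `\` \bigcup_(i in `I_n) S i.
have mF n : measurable (F n).
  by apply: measurableD; [exact: bigcupT_measurable|exact: bigcup_measurable].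
have [||n Fn] := @vanishing_measure_small _ _ _
  (nu \x kappa)%E F mF _ _ _ eta20.
- move=> m n mn; apply/subsetPset => z [Sz nz]; split => // z'; apply: nz.
  move: z' => -[i /= im Siz].
  by exists i => //=; exact: leq_trans mn.
- rewrite (_ : \bigcap_n F n = set0) ?measure0//.
  rewrite -subset0 => z Fz; have [[i _ Siz] _] := Fz 0%N I.
  by have [_] := Fz i.+1 I; apply; exists i => /=.
have [del del0 [e [me e0 ie He]]] := section_approxN n mS aS eta20.
exists del => //; exists (fun x => e x + kappa (xsection (F n) x))%E.
have mk : measurable_fun setT (fun x => kappa (xsection (F n) x)).
  exact: measurable_fun_xsection.
split.
- exact: emeasurable_funD.
- by move=> x; rewrite adde_ge0.
- by rewrite ge0_integralD// (splitr eta) EFinD leeD// ltW.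
- move=> x x' xx' /=; rewrite addeACA.
  pose D_ i := xsection (S i) x `\` xsection (S i) x'.
  pose D := \big[setU/set0]_(i < n) D_ i.
  have mD : measurable D.
    by apply: bigsetU_measurable => i _; apply: measurableD; exact: msec.
  have mFx : measurable (xsection (F n) x) by exact: msec.
  apply: (@le_trans _ _ (kappa (D `|` xsection (F n) x))).
    apply: le_measure; rewrite ?inE.
    + by apply: measurableD; apply: msec; exact: bigcupT_measurable.
    + exact: measurableU.
    + move=> y [/xsectionP Uy Uy']; have [Dy|Dy] := pselect (D y); first
        by left.
      right; apply/xsectionP; split=> // -[i /= im Siy]; apply: Dy.
      rewrite /D -bigcup_mkord; exists i => //; split; first exact/xsectionP.
      by move=> /xsectionP Siy'; apply: Uy'; apply/xsectionP; exists i.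
  apply: (le_trans (measureU2 _ _ _)) => //; apply: leeD.
    apply: (le_trans (Boole_inequality _ _)) => //.
      by move=> i _; apply: measurableD; exact: msec.
    exact: He.
  by rewrite leeDl.
Qed.

Lemma section_approx_snd (A : set Y) : section_approx (snd @^-1` A).
Proof.
move=> eta eta0; exists 1 => //; exists (cst 0%E); split => //.
  by rewrite integral0 lee_fin ltW.
move=> x x' _; rewrite (_ : _ `\` _ = set0) ?measure0 ?adde0//.
by rewrite -subset0 => y [/xsectionP Ay]; apply; apply/xsectionP.
Qed.

(** Fibers are full or empty, so only [x] in [P] with [x'] outside [P] matters. Then [x] lies in
    [F n], the part of [P] within [1/(n+1)] of the complement. These sets decrease to the empty set
    because [P] is open, and the indicator of one of them is the error function. *)
Lemma section_approx_open (P : set X) : open P -> section_approx (fst @^-1` P).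
Proof.
move=> oP eta eta0.
pose Q n := \bigcup_(x in ~` P) ball x (n.+1%:R^-1 : R).
have oQ n : open (Q n).
  apply: bigcup_open => x _; rewrite openE => y; rewrite ballEmdist /= => xy.
  apply/nbhs_ballP; exists (n.+1%:R^-1 - mdist x y) => /=; first
    by rewrite subr_gt0.
  move=> z; rewrite !ballEmdist /= ltrBrDl.
  exact/le_lt_trans/metric_triangle.
pose F n := P `&` Q n.
have mF n : measurable (F n) by apply: measurableI;
  exact: borel_open_measurable.
have [||n Fn] := @vanishing_measure_small _ _ _ nu F mF _ _ _ eta0.
- move=> m n mn; apply/subsetPset => x [Px [z nPz zx]]; split => //.
  exists z => //; apply: le_ball zx.
  by rewrite lef_pV2 ?posrE// ler_nat ltnS.
- rewrite (_ : \bigcap_n F n = set0) ?measure0//.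
  rewrite -subset0 => x Fx; have [Px _] := Fx 0%N I.
  have /nbhs_ballP[r /= r0 rP] : nbhs x P by apply: open_nbhs_nbhs.
  have [n] := near_infty_natSinv_lt (PosNum r0); move=> _ /(_ n (leqnn _)) nr.
  have [_ [z nPz zx]] := Fx n I; apply: nPz; apply: rP.
  by apply: ball_sym; apply: le_ball zx; exact: ltW.
exists n.+1%:R^-1; first by rewrite invr_gt0.
exists (EFin \o \1_(F n)); split.
- exact/measurable_EFinP.
- by move=> x; rewrite lee_fin.
- by rewrite integral_indic// setIT ltW.
- move=> x x' xx'; have [[Px nPx']|H] := pselect (P x /\ ~ P x'); last first.
    rewrite (_ : _ `\` _ = set0) ?measure0 ?adde_ge0 ?lee_fin//.
    rewrite -subset0 => y [/xsectionP /= Px Px']; apply: H; split => // Px''.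
    by apply: Px'; apply/xsectionP.
  rewrite (@le_trans _ _ 1%E)// ?probability_le1//.
    by apply: measurableD; apply: msec; rewrite -[X in measurable X]setTI;
      apply: measurable_fst => //; exact: borel_open_measurable.
  rewrite /= indicE mem_set/=; first by rewrite leeDl// lee_fin.
  by split => //; exists x' => //; rewrite ballEmdist /= metric_sym.
Qed.

Lemma measurable_section_approx S : measurable S -> section_approx S.
Proof.
have mfst A : measurable A -> measurable (@fst X Y @^-1` A).
  by move=> mA; rewrite -[X in measurable X]setTI; exact: measurable_fst.
have msnd A : measurable A -> measurable (@snd X Y @^-1` A).
  by move=> mA; rewrite -[X in measurable X]setTI; exact: measurable_snd.
(* The good sets form a sigma-algebra, so generators suffice; measurability is carried along because
   the union step uses it. The argument runs twice: for the product sigma-algebra over cylinders,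
   then for the Borel sets of [X] over open sets. *)
suff : measurable `<=` [set A : set (X * Y) | measurable A /\ section_approx A].
  by move=> H /H[].
apply: smallest_sub.
  split => /=.
  - split => //; have := @section_approx_snd set0.
    by rewrite preimage_set0.
  - move=> A [mA aA]; rewrite setTD; split; first exact: measurableC.
    exact: section_approxC.
  - move=> F FH; split; first by apply: bigcupT_measurable => i;
      have [] := FH i.
    by apply: section_approx_bigcup => i; have [] := FH i.
move=> A [|] [B mB <-]; rewrite setTI; split;
  [exact: mfst| |exact: msnd|exact: section_approx_snd].
have : measurable `<=` [set A |
  measurable A /\ section_approx (@fst X Y @^-1` A)].
  rewrite [X in X `<=` _]borelX; apply: smallest_sub; last first.
    move=> P oP; split; last exact: section_approx_open.
    exact: borel_open_measurable.
  split => /=.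
  - by split => //; have := @section_approx_snd set0; rewrite !preimage_set0.
  - move=> P [mP aP]; rewrite setTD; split; first exact: measurableC.
    exact: section_approxC.
  - move=> F FH; split; first by apply: bigcupT_measurable => i;
      have [] := FH i.
    rewrite preimage_bigcup; apply: section_approx_bigcup => i; last
      by have [] := FH i.
    by apply: mfst; have [] := FH i.
by move=> /(_ B mB)[].
Qed.

End section_approximation.

(** * The mass of zeta *)

Section countable_sums.
Context (R : realType) (I : choiceType).
Hypothesis countI : countable [set: I].
Local Open Scope ereal_scope.

Lemma countable_enum (i0 : I) : exists e : I -> nat, exists s : nat -> I,
  cancel e s.
Proof.
have /countable_injP[e einj] := countI.
exists e; exists (fun n => xget i0 [set i | e i = n]) => i.
case: xgetP => [j _ /= eji|/(_ i) /=/(_ erefl)//].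
by apply: einj; rewrite ?inE.
Qed.

(** One enumeration, chosen before [a], serves all families; hence facts on series of functions
    carry over to sums over [I]. *)
Lemma esum_eseries (i0 : I) : exists (P : pred nat) (s : nat -> I),
  forall a : I -> \bar R, (forall i, 0 <= a i) ->
  \esum_(i in [set: I]) a i = \sum_(n <oo | P n) a (s n).
Proof.
have [e [s es]] := countable_enum i0.
exists (fun n => n \in range e), s => a a0.
rewrite nneseries_esum// set_mem_set esum_image; last first.
  by move=> i j _ _; exact: (can_inj es).
by apply: eq_esum => i _; rewrite es.
Qed.

Lemma integral_esum (i0 : I) d (T : measurableType d)
    (mu : {measure set T -> \bar R}) (f : I -> T -> \bar R) :
  (forall i, measurable_fun setT (f i)) -> (forall i x, 0 <= f i x) ->
  \int[mu]_x (\esum_(i in [set: I]) f i x) =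
  \esum_(i in [set: I]) \int[mu]_x f i x.
Proof.
move=> mf f0; have [P [s Ps]] := esum_eseries i0.
rewrite Ps; last by move=> i; exact: integral_ge0.
rewrite (eq_integral (fun x => \sum_(n <oo) (if P n then f (s n) x else 0))).
  2: by move=> x _; rewrite Ps// eseries_mkcond.
rewrite integral_nneseries//.
- rewrite (@eseries_mkcond _ P (fun n => \int[mu]_x f (s n) x)).
  apply: eq_eseriesr => n _.
  by case: (P n); rewrite ?integral0.
- by move=> n; case: (P n) => //; exact: measurable_cst.
- by move=> n x _; case: (P n).
Qed.

Lemma measurable_esum (i0 : I) d (T : measurableType d) (f : I -> T -> \bar R) :
  (forall i, measurable_fun setT (f i)) -> (forall i x, 0 <= f i x) ->
  measurable_fun setT (fun x => \esum_(i in [set: I]) f i x).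
Proof.
move=> mf f0; have [P [s Ps]] := esum_eseries i0.
under eq_fun do rewrite Ps//.
by apply: ge0_emeasurable_sum.
Qed.

Lemma ae_forall_countable (i0 : I) d (T : measurableType d)
    (mu : {measure set T -> \bar R}) (P : I -> T -> Prop) :
  (forall i, {ae mu, forall x, P i x}) -> {ae mu, forall x i, P i x}.
Proof.
have [e [s es]] := countable_enum i0.
move=> H; have : {ae mu, forall x n, P (s n) x}.
  by apply: ae_foralln => n; exact: H.
by apply: filterS => x + i => /(_ (e i)); rewrite es.
Qed.

End countable_sums.

(** * Averages of an error function against the transfer functions *)

Section zeta_bound.
Context (R : realType) (G : groupType) d (X : measurableType d).
Variables (a : measurable_action G X) (nu : probability X R).
Hypothesis qi : quasi_invariant a nu.
Hypothesis countG : countable [set: G].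
Local Open Scope ereal_scope.

(** By Tonelli the sum and the [y]-integral apply to [k] alone, where they give at most [C] for
    almost every [x]; the weight [w] factors out. *)
Lemma esum_weighted_le (w : X -> \bar R) (k : G -> X -> X -> \bar R) (C : R) :
  measurable_fun setT w -> (forall x, 0 <= w x) ->
  (forall g, measurable_fun [set: X * X] (fun p => k g p.1 p.2)) ->
  (forall g x y, 0 <= k g x y) ->
  {ae nu, forall x, \int[nu]_y (\esum_(g in [set: G]) k g x y) <= C%:E} ->
  \esum_(g in [set: G]) \int[nu]_x \int[nu]_y (w x * k g x y)
    <= C%:E * \int[nu]_x w x.
Proof.
move=> mw w0 mk k0 kC.
have mky g x : measurable_fun setT (k g x).
  exact: (measurableT_comp (mk g) (pair1_measurable x)).
pose K g x := \int[nu]_y k g x y.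
have K0 g x : 0 <= K g x by exact: integral_ge0.
have mK g : measurable_fun setT (K g).
  exact: (measurable_fun_fubini_tonelli_F _ (mk g) (fun p => k0 g p.1 p.2)).
rewrite (eq_esum (b := fun g => \int[nu]_x (w x * K g x))); last first.
  by move=> g _; apply: eq_integral => x _; rewrite ge0_integralZl.
rewrite -(integral_esum countG 1%g)//; last 2 first.
- by move=> g; apply: emeasurable_funM => //; exact: mK.
- by move=> g x; rewrite mule_ge0.
(* A negative [C] would make the almost everywhere bound fail at every point, against
   [nu setT = 1]. *)
have C0 : (0 <= C)%R.
  have [C0|C0] := leP 0%R C => //; exfalso.
  have : nu setT = 0.
    have [N [mN N0 sN]] := kC; rewrite (_ : setT = N)//.
    apply/esym/seteqP; split => // x _; apply: sN => /=; apply/negP.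
    rewrite -ltNge (@lt_le_trans _ _ 0)// ?lte_fin//.
    by apply: integral_ge0 => y _; exact: esum_ge0.
  by move/eqP; rewrite probability_setT onee_eq0.
rewrite -ge0_integralZl//.
apply: ae_ge0_le_integral => //.
- by move=> x _; apply: esum_ge0 => g _; rewrite mule_ge0.
- apply: (measurable_esum countG 1%g) => [g|g x]; last by rewrite mule_ge0.
  by apply: emeasurable_funM => //; exact: mK.
- by move=> x _; rewrite mule_ge0.
- exact: measurable_funeM.
apply: filterS kC => x + _; rewrite (integral_esum countG 1%g)// => kC.
apply: (@le_trans _ _ (w x * \esum_(g in [set: G]) K g x)); last first.
  by rewrite muleC lee_wpmul2r.
(* Only an inequality is needed, so [w x] is taken out of finite partial sums. *)
apply: ge_ereal_sup => _ [F [finF _] <-].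
rewrite -ge0_mule_fsumr//; apply: lee_wpmul2l => //.
by apply: ereal_sup_ubound; exists F.
Qed.

Variables (O : set X) (U : transfer_function R G X).
Hypothesis mO : measurable O.

(** Multiply the pointwise bound by [U] and integrate. The term [q b] is controlled by
    normalization, and [e b'], [e (g^-1 b')], [e (g^-1 b)] by the three bounds of admissibility in
    this order, whence the factor 3. *)
Lemma zeta_le (q e : X -> \bar R) (V : set R) (C : R) :
  measurable_fun setT q -> (forall x, 0 <= q x) ->
  measurable_fun setT e -> (forall x, 0 <= e x) ->
  measurable V -> (0 <= C)%R ->
  (forall g, {ae nu \x nu, forall p : X * X, O p.1 -> (0 < U g p.1 p.2)%R ->
    (\1_V (logRN a nu (g^-1)%g p.2 - logRN a nu (g^-1)%g p.1))%:E <=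
    q p.1 + (e p.2 + (e (a (g^-1)%g p.1) + e (a (g^-1)%g p.2)))}) ->
  (forall b, \esum_(g in [set: G]) \int[nu]_b' (U g b b')%:E = 1) ->
  {ae nu, forall b', \int[nu]_(b in O)
     (\esum_(g in [set: G]) (U g b b')%:E) <= C%:E} ->
  {ae nu, forall b', \int[nu]_(b in O)
     (\esum_(g in [set: G]) (U g b (a g b') * RN a nu g b')%:E) <= C%:E} ->
  {ae nu, forall b, \int[nu]_b'
     (\esum_(g in [set: G])
        (\1_O (a g b) * U g (a g b) b' * RN a nu g b)%:E) <= C%:E} ->
  zeta a nu O U V <= \int[nu]_x q x + (3 * C)%:E * \int[nu]_x e x.
Proof.
move=> mq q0 me e0 mV C0 qe U1 UC1 UC2 UC3.
pose rp g x := Num.max 0%R (RN a nu g x).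
have rp0 g x : (0 <= rp g x)%R by rewrite le_max lexx.
have mrp g : measurable_fun setT (rp g).
  by apply/measurable_maxr => //; exact: measurable_RN.
have rpE : {ae nu, forall x g, RN a nu g x = rp g x}.
  apply: (ae_forall_countable countG 1%g) => g.
  by apply: filterS (RN_gt0 qi g) => x /ltW ?; rewrite /rp max_r.
pose u g b b' := (\1_O b * U g b b')%:E.
have u0 g b b' : 0 <= u g b b'.
  by rewrite lee_fin mulr_ge0// transfer_ge0.
have mu g : measurable_fun [set: X * X] (fun p => u g p.1 p.2).
  apply/measurable_EFinP; apply: measurable_funM;
    last exact: measurable_transfer.
  by apply: (@measurableT_comp _ _ _ _ _ _ (\1_O : X -> R)).
have mag g : measurable_fun setT (a g) by exact: measurable_act.
have mfst (f : X -> \bar R) : measurable_fun setT f ->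
  measurable_fun [set: X * X] (fun p => f p.1).
  by move=> mf; apply: (@measurableT_comp _ _ _ _ _ _ f).
have msnd (f : X -> \bar R) : measurable_fun setT f ->
  measurable_fun [set: X * X] (fun p => f p.2).
  by move=> mf; apply: (@measurableT_comp _ _ _ _ _ _ f).
have meg g : measurable_fun setT (fun x => e (a (g^-1)%g x)).
  exact: (measurableT_comp me (mag _)).
pose L g (p : X * X) := (\1_V (logRN a nu (g^-1)%g p.2 -
  logRN a nu (g^-1)%g p.1))%:E * u g p.1 p.2.
have mL g : measurable_fun [set: X * X] (L g).
  apply: emeasurable_funM => //; apply/measurable_EFinP.
  apply: (@measurableT_comp _ _ _ _ _ _ (\1_V : R -> R)).
    exact: measurable_indic.
  by apply: measurable_funB; apply: measurableT_comp => //;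
    exact: measurable_logRN.
have L0 g p : 0 <= L g p by rewrite mule_ge0.
have zE : zeta a nu O U V = \esum_(g in [set: G]) \int[nu \x nu]_p L g p.
  apply: eq_esum => g _; rewrite (fubini_tonelli2 _ (mL g) (L0 g)).
  apply: eq_integral => y _; apply: eq_integral => x _.
  by rewrite /L /u -EFinM mulrA.
pose H1 g (p : X * X) := q p.1 * u g p.1 p.2.
pose H2 g (p : X * X) := e p.2 * u g p.1 p.2.
pose H3 g (p : X * X) := e (a (g^-1)%g p.1) * u g p.1 p.2.
pose H4 g (p : X * X) := e (a (g^-1)%g p.2) * u g p.1 p.2.
have H10 g p : 0 <= H1 g p by rewrite mule_ge0.
have H20 g p : 0 <= H2 g p by rewrite mule_ge0.
have H30 g p : 0 <= H3 g p by rewrite mule_ge0.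
have H40 g p : 0 <= H4 g p by rewrite mule_ge0.
have mH1 g : measurable_fun setT (H1 g)
  by apply: emeasurable_funM => //; exact: mfst.
have mH2 g : measurable_fun setT (H2 g)
  by apply: emeasurable_funM => //; exact: msnd.
have mH3 g : measurable_fun setT (H3 g).
  by apply: emeasurable_funM => //; exact: mfst (meg g).
have mH4 g : measurable_fun setT (H4 g).
  by apply: emeasurable_funM => //; exact: msnd (meg g).
have mH34 g : measurable_fun setT (H3 g \+ H4 g) by exact: emeasurable_funD.
have mH234 g : measurable_fun setT (H2 g \+ (H3 g \+ H4 g)).
  exact: emeasurable_funD.
have step : zeta a nu O U V <= \esum_(g in [set: G]) (\int[nu \x nu]_p H1 g p +
   (\int[nu \x nu]_p H2 g p + (\int[nu \x nu]_p H3 g p +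
     \int[nu \x nu]_p H4 g p))).
  rewrite zE; apply: le_esum => g _.
  apply: (@le_trans _ _ (\int[nu \x nu]_p (H1 g p + (H2 g p + (H3 g p +
    H4 g p))))).
    apply: ae_ge0_le_integral => //.
    - by move=> p _; rewrite !adde_ge0.
    - exact: emeasurable_funD.
    - apply: filterS (qe g) => p qp _.
      rewrite /H1 /H2 /H3 /H4 -!ge0_muleDl ?adde_ge0//.
      (* Outside [O], or where [U] vanishes, the left side is 0, so [qe] is needed only where its
         premises hold. *)
      have [Op|Op] := pselect (O p.1); last first.
        by rewrite /L /u [\1_O _]indicE memNset// mul0r !mule0.
      have [U0|U0] := ltP 0%R (U g p.1 p.2).
        exact: lee_wpmul2r (qp Op U0).
      suff -> : L g p = 0 by rewrite mule_ge0 ?adde_ge0.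
      have Ue : U g p.1 p.2 = 0%R by apply/eqP; rewrite eq_le U0 transfer_ge0.
      by rewrite /L /u Ue mulr0 mule0.
  rewrite ge0_integralD//; last by move=> p _; rewrite !adde_ge0.
  rewrite leeD2l// ge0_integralD//; last by move=> p _; rewrite !adde_ge0.
  by rewrite leeD2l// ge0_integralD.
have i1 g : 0 <= \int[nu \x nu]_p H1 g p
  by apply: integral_ge0 => p _; exact: H10.
have i2 g : 0 <= \int[nu \x nu]_p H2 g p
  by apply: integral_ge0 => p _; exact: H20.
have i3 g : 0 <= \int[nu \x nu]_p H3 g p
  by apply: integral_ge0 => p _; exact: H30.
have i4 g : 0 <= \int[nu \x nu]_p H4 g p
  by apply: integral_ge0 => p _; exact: H40.
have i34 g := adde_ge0 (i3 g) (i4 g).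
have i234 g := adde_ge0 (i2 g) (i34 g).
apply: (le_trans step).
rewrite (esumD (fun g _ => i1 g) (fun g _ => i234 g)).
rewrite (esumD (fun g _ => i2 g) (fun g _ => i34 g)).
rewrite (esumD (fun g _ => i3 g) (fun g _ => i4 g)).
have Oint (f : X -> G -> \bar R) : (forall x g, 0 <= f x g) ->
   \int[nu]_(x in O) (\esum_(g in [set: G]) f x g) =
   \int[nu]_x (\esum_(g in [set: G]) ((\1_O x)%:E * f x g)).
  move=> f0; rewrite integral_mkcond; apply: eq_integral => x _.
  rewrite /patch indicE; case: ifP => xO.
    by apply: eq_esum => g _; rewrite mul1e.
  by rewrite esum1// => g _; rewrite mul0e.
have mux g x : measurable_fun setT (u g x).
  exact: (measurableT_comp (mu g) (pair1_measurable x)).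
have muT g : measurable_fun [set: X * X] (fun p => u g p.2 p.1).
  have mswap : measurable_fun [set: X * X] (fun p => (p.2, p.1)).
    by apply: measurable_fun_pair.
  exact: (measurableT_comp (mu g) mswap).
have mpair1 (h : X -> X) : measurable_fun setT h ->
    measurable_fun [set: X * X] (fun p => (h p.1, p.2)).
  move=> mh; apply: measurable_fun_pair => //.
  exact: (measurableT_comp mh measurable_fst).
(* Dropping the indicator of [O] and integrating over [b'] leaves total weight at most 1. *)
have I1 : \esum_(g in [set: G]) \int[nu \x nu]_p H1 g p <=
  1%:E * \int[nu]_x q x.
  rewrite (eq_esum (b := fun g => \int[nu]_x \int[nu]_y (q x * u g x y)));
    last first.
    by move=> g _; rewrite (fubini_tonelli1 _ (mH1 g) (H10 g)).
  apply: esum_weighted_le => //; apply: nearW => x.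
  rewrite (integral_esum countG 1%g)// -(U1 x); apply: le_esum => g _.
  apply: ge0_le_integral => //.
  - apply/measurable_EFinP.
    exact: (measurableT_comp (measurable_transfer U g) (pair1_measurable x)).
  - move=> y _; rewrite lee_fin; apply: ler_piMl; first exact: transfer_ge0.
    by rewrite indicE; case: (_ \in _).
have I2 : \esum_(g in [set: G]) \int[nu \x nu]_p H2 g p <=
  C%:E * \int[nu]_x e x.
  rewrite (eq_esum (b := fun g => \int[nu]_y \int[nu]_x (e y * u g x y)));
    last first.
    by move=> g _; rewrite (fubini_tonelli2 _ (mH2 g) (H20 g)).
  apply: (@esum_weighted_le e (fun g y x => u g x y)) => //.
  apply: filterS UC1 => y; rewrite (Oint (fun b g => (U g b y)%:E))//.
  by move=> b g; rewrite lee_fin transfer_ge0.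
have I3 : \esum_(g in [set: G]) \int[nu \x nu]_p H3 g p <=
  C%:E * \int[nu]_x e x.
  (* Substituting [a g x] for [x] turns [e (g^-1 x)] into [e x] at the cost of the derivative of
     [g], which is the weight in the third bound. *)
  pose k g x y := u g (a g x) y * (rp g x)%:E.
  have mk g : measurable_fun [set: X * X] (fun p => k g p.1 p.2).
    apply: emeasurable_funM.
      exact: (measurableT_comp (mu g) (mpair1 _ (mag g))).
    by apply: (mfst (fun x => (rp g x)%:E)); exact/measurable_EFinP.
  have k0 g x y : 0 <= k g x y by apply: mule_ge0; [exact: u0|exact: rp0].
  rewrite (eq_esum (b := fun g => \int[nu]_x \int[nu]_y (e x * k g x y))).
    apply: esum_weighted_le => //.
    apply: filterS2 UC3 rpE => x + rpx.
    congr (_ <= _); apply: eq_integral => y _; apply: eq_esum => g _.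
    by rewrite /k /u -EFinM -rpx.
  move=> g _; rewrite (fubini_tonelli1 _ (mH3 g) (H30 g)).
  have mF := measurable_fun_fubini_tonelli_F (m2 := nu) _ (mH3 g) (H30 g).
  rewrite (RN_change_of_variables qi g mF); last first.
    by move=> x; apply: integral_ge0 => y _; exact: H30.
  apply: ae_eq_integral => //.
  - apply: emeasurable_funM; first exact: (measurableT_comp mF (mag g)).
    by apply/measurable_EFinP; exact: measurable_RN.
  - have mek : measurable_fun [set: X * X] (fun p => e p.1 * k g p.1 p.2).
      by apply: emeasurable_funM => //; exact: mfst.
    apply: (measurable_fun_fubini_tonelli_F _ mek).
    by move=> p; rewrite mule_ge0.
  - apply: filterS rpE => x rpx _ /=; rewrite /fubini_F /H3 /= actK rpx.
    rewrite -ge0_integralZr ?lee_fin//.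
    + by apply: eq_integral => y _; rewrite muleA.
    + by apply: emeasurable_funM.
    + by move=> y _; rewrite mule_ge0.
have I4 : \esum_(g in [set: G]) \int[nu \x nu]_p H4 g p <=
  C%:E * \int[nu]_x e x.
  (* The same substitution in the second coordinate. The arguments are swapped because the weight
     now sits at [y], which must be the outer variable. *)
  pose k g y x := u g x (a g y) * (rp g y)%:E.
  have mk g : measurable_fun [set: X * X] (fun p => k g p.1 p.2).
    apply: emeasurable_funM.
      exact: (measurableT_comp (muT g) (mpair1 _ (mag g))).
    by apply: (mfst (fun x => (rp g x)%:E)); exact/measurable_EFinP.
  have k0 g x y : 0 <= k g x y by apply: mule_ge0; [exact: u0|exact: rp0].
  rewrite (eq_esum (b := fun g => \int[nu]_y \int[nu]_x (e y * k g y x))).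
    apply: esum_weighted_le => //.
    apply: filterS2 UC2 rpE => y + rpy.
    rewrite (eq_integral (fun b => \esum_(g in [set: G])
      (U g b (a g y) * rp g y)%:E)); last first.
      by move=> b _; apply: eq_esum => g _; rewrite rpy.
    rewrite (Oint (fun b g => (U g b (a g y) * rp g y)%:E)); last first.
      by move=> b g; rewrite lee_fin mulr_ge0// transfer_ge0.
    congr (_ <= _); apply: eq_integral => b _; apply: eq_esum => g _.
    by rewrite /k /u -!EFinM mulrA.
  move=> g _; rewrite (fubini_tonelli2 _ (mH4 g) (H40 g)).
  have mF := measurable_fun_fubini_tonelli_G (m1 := nu) _ (mH4 g) (H40 g).
  rewrite (RN_change_of_variables qi g mF); last first.
    by move=> y; apply: integral_ge0 => x _; exact: H40.
  apply: ae_eq_integral => //.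
  - apply: emeasurable_funM; first exact: (measurableT_comp mF (mag g)).
    by apply/measurable_EFinP; exact: measurable_RN.
  - have mek : measurable_fun [set: X * X] (fun p => e p.1 * k g p.1 p.2).
      by apply: emeasurable_funM => //; exact: mfst.
    apply: (measurable_fun_fubini_tonelli_F _ mek).
    by move=> p; rewrite mule_ge0.
  - apply: filterS rpE => y rpy _ /=; rewrite /fubini_G /H4 /= actK rpy.
    rewrite -ge0_integralZr ?lee_fin//.
    + by apply: eq_integral => x _; rewrite muleA.
    + apply: emeasurable_funM => //.
      exact: (measurableT_comp (muT g) (pair1_measurable (a g y))).
    + by move=> x _; rewrite mule_ge0.
rewrite mul1e in I1; apply: leeD => //.
apply: (le_trans (leeD I2 (leeD I3 I4))).
rewrite (_ : 3 * C = C + (C + C))%R; last by ring.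
by rewrite !EFinD !ge0_muleDl// ?lee_fin ?addr_ge0.
Qed.

End zeta_bound.

(** * Returns to a set in a product action *)

Section ae_product.
Context (R : realType) d (X : measurableType d) d' (Y : measurableType d').
Variables (nu : probability X R) (kappa : probability Y R).

Lemma ae_product_fst (P : X -> Prop) : {ae nu, forall x, P x} ->
  {ae (nu \x kappa)%E, forall p : X * Y, P p.1}.
Proof.
move=> [N [mN N0 sN]]; exists (N `*` setT); split.
- exact: measurableX.
- apply: etrans (product_measure1E nu kappa mN measurableT) _.
  by rewrite [X in (X * _)%E](_ : _ = 0%E) ?mul0e.
- by move=> p /= /sN.
Qed.

Lemma ae_product_snd (P : Y -> Prop) : {ae kappa, forall y, P y} ->
  {ae (nu \x kappa)%E, forall p : X * Y, P p.2}.
Proof.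
move=> [N [mN N0 sN]]; exists (setT `*` N); split.
- exact: measurableX.
- apply: etrans (product_measure1E nu kappa measurableT mN) _.
  by rewrite [X in (_ * X)%E](_ : _ = 0%E) ?mule0.
- by move=> p /= /sN.
Qed.

End ae_product.

Section saturation.
Context (R : realType) (G : groupType) d (X : measurableType d) d'
  (Y : measurableType d').
Variables (a : measurable_action G X) (b : measurable_action G Y).
Variables (nu : probability X R) (kappa : probability Y R).
Hypothesis countG : countable [set: G].
Hypothesis qi : quasi_invariant a nu.
Hypothesis mp : measure_preserving b kappa.
Local Notation c := (product_action a b).
Local Notation rho := (logRN a nu).
Local Notation fdist S x x' := (kappa (xsection S x `\` xsection S x')).

(** At these points the rules for [RN] hold exactly and for all group elements at once, so hits can
    be composed without tracking null sets. *)
Definition cocycle_point x := forall g, 0 < RN a nu g x /\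
  forall h, RN a nu (g * h)%g x = RN a nu g (a h x) * RN a nu h x.

Lemma ae_cocycle_point : {ae nu, forall x, cocycle_point x}.
Proof.
apply: (ae_forall_countable countG 1%g) => g.
by apply: filterS2 (RN_gt0 qi g)
  (ae_forall_countable countG 1%g (RN_cocycle qi g)).
Qed.

(** The derivatives at [a g x] are quotients of derivatives at [x], so the rules at [x] imply those
    at [a g x]. *)
Lemma cocycle_point_act g x : cocycle_point x -> cocycle_point (a g x).
Proof.
move=> px.
have RNa h : RN a nu h (a g x) = RN a nu (h * g)%g x / RN a nu g x.
  have [g0 _] := px g; have [_ ->] := px h.
  by rewrite mulfK// gt_eqF.
move=> h; have [g0 _] := px g; have [hg0 _] := px (h * g)%g.
rewrite RNa divr_gt0//; split => // k.
have [_ hM] := px h.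
by rewrite !RNa -actM -mulgA hM mulrA.
Qed.

Lemma logRN_cocycle g h x : cocycle_point x -> cocycle_point (a h x) ->
  rho (g * h)%g x = rho g (a h x) + rho h x.
Proof.
move=> px phx; rewrite /logRN; have [_ ->] := px g.
by rewrite lnM// posrE; [have [] := phx g|have [] := px h].
Qed.

Lemma logRN1 x : cocycle_point x -> rho 1%g x = 0.
Proof.
move=> px; have := @logRN_cocycle 1%g 1%g x px.
rewrite act1 mulg1 => /(_ px) /eqP.
by rewrite -subr_eq0 opprD addrA subrr sub0r oppr_eq0 => /eqP.
Qed.

Lemma logRNV g x : cocycle_point x -> cocycle_point (a (g^-1)%g x) ->
  rho g (a (g^-1)%g x) = - rho (g^-1)%g x.
Proof.
move=> px pgx; apply/eqP; rewrite -addr_eq0 -logRN_cocycle//.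
by rewrite mulgV logRN1.
Qed.

(** The set [B_J] of the overview. The cocycle is read off the first coordinate because the action
    on [Y] preserves [kappa]. *)
Definition hits (A : set (X * Y)) (J : set R) : set (X * Y) :=
  [set p | exists2 g, A (c g p) & J (rho g p.1)].

Lemma measurable_hits A J : measurable A -> measurable J ->
  measurable (hits A J).
Proof.
move=> mA mJ.
rewrite (_ : hits A J = \bigcup_g (c g @^-1` A `&` 
  (fun p => rho g p.1) @^-1` J)).
  apply: countable_bigcupT_measurable => // g; apply: measurableI.
    by rewrite -[X in measurable X]setTI; exact: measurable_act.
  rewrite -[X in measurable X]setTI.
  have mrho : measurable_fun [set: X * Y] (fun p => rho g p.1).
    apply: measurableT_comp measurable_fst => //; exact: measurable_logRN.
  exact: mrho.
by apply/seteqP; split=> [p [g Ag Jg]|p [g _ [Ag Jg]]]; exists g.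
Qed.

Lemma measure_act_preimage g (S : set Y) : measurable S ->
  kappa (b g @^-1` S) = kappa S.
Proof. by move=> mS; rewrite -{1}(invgK g) -image_actE mp. Qed.

Hypothesis erg : ergodic a nu.

(** [hits A setT] is the saturation of [A], so its fiber measure is an invariant function on [X]. By
    ergodicity its zero set is null or conull; if conull, the saturation would be null although it
    contains [A]. *)
Lemma saturation_fiber_gt0 A : measurable A -> (0 < (nu \x kappa) A)%E ->
  nu [set x | kappa (xsection (hits A setT) x) = 0%E] = 0%E.
Proof.
move=> mA A0; have mS := measurable_hits mA measurableT.
have mk : measurable_fun setT (fun x => kappa (xsection (hits A setT) x)).
  exact: measurable_fun_xsection.
set Z := [set x | _].
have mZ : measurable Z.
  rewrite -[Z]setTI.
  exact: (mk measurableT [set 0%E] (emeasurable_set1 0%E)).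
have kinv g x : kappa (xsection (hits A setT) (a g x)) =
    kappa (xsection (hits A setT) x).
  rewrite -(@measure_act_preimage g); last exact: measurable_xsection.
  congr (kappa _); apply/seteqP; split => y /=.
    move=> /xsectionP[h Ah _]; apply/xsectionP; exists (h * g)%g => //.
    by rewrite actM.
  move=> /xsectionP[h Ah _]; apply/xsectionP; exists (h * g^-1)%g => //.
  by rewrite actM (actK c g (x, y)).
have [//|Z1] : nu Z = 0%E \/ nu Z = 1%E.
  apply: erg => // g; apply/seteqP; split => [_ [x Zx <-]|x Zx].
    by rewrite /Z /= kinv.
  exists (a (g^-1)%g x); last by rewrite actVK.
  by rewrite /Z /= kinv.
suff : (nu \x kappa)%E A = 0%E by move=> A00; rewrite A00 ltxx in A0.
apply/eqP; rewrite -measure_le0.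
apply: (@le_trans _ _ ((nu \x kappa)%E (hits A setT))).
  apply: le_measure; rewrite ?inE// => p Ap; exists 1%g => //.
  by rewrite act1.
rewrite (_ : (nu \x kappa)%E (hits A setT) =
  \int[nu]_x kappa (xsection (hits A setT) x))%E//.
rewrite (ae_eq_integral (cst 0%E))//; first by rewrite integral0.
have Z0 : nu (~` Z) = 0%E by rewrite probability_setC// Z1 subee.
exists (~` Z); split; [exact: measurableC|exact: Z0|].
by move=> x /= /not_implyP[_ ?].
Qed.

(** One index bounds the cocycle by [n] and sets the threshold [1/(n+1)], so these sets decrease.
    Their intersection lies in the null set of [saturation_fiber_gt0]. *)
Lemma hits_fiber_gt A (eta : R) : measurable A -> (0 < (nu \x kappa) A)%E ->
  0 < eta -> exists n : nat, (nu [set x |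
    kappa (xsection (hits A [set r | (`|r| <= n%:R)%R]) x) <= (n.+1%:R^-1)%:E]
    < eta%:E)%E.
Proof.
move=> mA A0 eta0.
pose J n : set R := [set r | `|r| <= n%:R].
have mJ n : measurable (J n).
  by rewrite -[J n]setTI; apply: measurable_fun_le => //;
    exact: measurable_normr.
pose S n := hits A (J n).
have mS n : measurable (S n) by apply: measurable_hits => //; exact: mJ.
pose k n x := kappa (xsection (S n) x).
have mk n : measurable_fun setT (k n)
  by apply: measurable_fun_xsection; exact: mS.
have kle m n x : (m <= n)%N -> (k m x <= k n x)%E.
  move=> mn; apply: le_measure; rewrite ?inE; [apply: measurable_xsection;
    exact: mS..|].
  move=> y /xsectionP[g Ag Jg]; apply/xsectionP; exists g => //.
  by apply: le_trans Jg _; rewrite ler_nat.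
pose F n := [set x | (k n x <= (n.+1%:R^-1)%:E)%E].
have mF n : measurable (F n).
  by rewrite -[F n]setTI; apply: (emeasurable_fun_le measurableT (mk n)).
have [||n Fn] := @vanishing_measure_small _ _ _ nu F mF _ _ _ eta0; last first.
  by exists n.
  apply/eqP; rewrite -measure_le0 -(saturation_fiber_gt0 mA A0).
  apply: le_measure; rewrite ?inE; first exact: bigcapT_measurable.
    rewrite -[X in measurable X]setTI.
    have mkT : measurable_fun setT (fun x => kappa (xsection (hits A setT) x)).
      by apply: measurable_fun_xsection; exact: measurable_hits.
    exact: (mkT measurableT [set 0%E] (emeasurable_set1 0%E)).
  (* For every [m >= n] one has [k n x <= k m x <= 1/(m+1)]. *)
  move=> x Fx; have k0 n : k n x = 0%E.
    apply/eqP; rewrite eq_le measure_ge0 andbT.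
    apply/lee_addgt0Pr => e e0; rewrite add0e.
    have [N _ HN] := near_infty_natSinv_lt (PosNum e0).
    apply: (le_trans (kle n (maxn n N) x (leq_maxl _ _))).
    apply: (le_trans (Fx (maxn n N) I)); rewrite lee_fin ltW//.
    exact: (HN _ (leq_maxr _ _)).
  have mT : measurable (xsection (hits A setT) x).
    by apply: measurable_xsection; exact: measurable_hits.
  apply: measure_negligible => //.
  apply: (negligibleS (A := \bigcup_n xsection (S n) x)).
    move=> y /xsectionP[g Ag _]; exists (Num.truncn `|rho g x|).+1 => //.
    apply/xsectionP; exists g => //; rewrite /J /= ltW//.
    by rewrite truncnS_gt.
  apply: negligible_bigcup => n; apply/negligibleP; first
    by apply: measurable_xsection; exact: mS.
  exact: k0.
move=> m n mn; apply/subsetPset => x; rewrite /F /= => Fx.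
apply: (le_trans (kle _ _ x mn)); apply: (le_trans Fx).
by rewrite lee_fin lef_pV2 ?posrE// ler_nat ltnS.

Qed.

(* The maps [g^-1] carry [x] and [x'] to close points, and [x], [x'] are close
   too.  So, if [(x, y)] hits [A] with cocycle [r], then, off small exceptional
   sets, it also hits [A] with cocycle near [r + Delta], where
   [Delta = rho g^-1 x' - rho g^-1 x]; composing the two hits gives a return
   from [A] to [A] with cocycle near [Delta], against the
   hypothesis on [A]. *)
Lemma hits_transfer (A : set (X * Y)) (J : nat -> set R) (M : nat)
    (T L C del eps : R) (g : G) (x x' : X) (y : Y) :
  (forall p h, cocycle_point p.1 -> A p -> h != 1%g -> A (c h p) ->
    eps < `|rho h p.1 - T|) ->
  (forall r, `|r| <= L + 2 * C + del -> exists2 j, (j < M)%N & J j r) ->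
  (forall j r s, J j r -> J j s -> `|r - s| <= del) ->
  0 <= L -> 0 <= del -> 2 * del < C^-1 -> 4 * del <= eps ->
  cocycle_point x -> cocycle_point x' ->
  `|rho (g^-1)%g x| + `|rho (g^-1)%g x'| < C ->
  C^-1 <= `|rho (g^-1)%g x - rho (g^-1)%g x'| ->
  `|rho (g^-1)%g x' - rho (g^-1)%g x - T| < eps / 2 ->
  hits A [set r | `|r| <= L] (x, y) ->
  exists2 j, (j < M)%N &
    (hits A (J j) (c (g^-1)%g (x, y)) /\ ~ hits A (J j) (c (g^-1)%g (x', y))) \/
    (hits A (J j) (x', y) /\ ~ hits A (J j) (x, y)).
Proof.
move=> Aret Jcov Jdiam L0 del0 delC deleps px px' RC RCV RT [h Ah /= hL].
set D := rho _ x' - rho _ x in RT.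
have CR : `|rho (g^-1)%g x| < C by apply: le_lt_trans RC; rewrite lerDl.
have CR' : `|rho (g^-1)%g x'| < C by apply: le_lt_trans RC; rewrite lerDr.
have C0 : 0 < C by apply: le_lt_trans CR.
have pgx := cocycle_point_act (g^-1)%g px.
have pgx' := cocycle_point_act (g^-1)%g px'.
(* The hit [h] from [x], seen from [g^-1 x], is [h g] with cocycle [r1]. *)
pose r1 := rho h x - rho (g^-1)%g x.
have hgE : c (h * g)%g (c (g^-1)%g (x, y)) = c h (x, y).
  by rewrite actM actVK.
have r1E : rho (h * g)%g (a (g^-1)%g x) = r1.
  by rewrite logRN_cocycle ?actVK// logRNV.
have [j1 j1M Jr1] : exists2 j, (j < M)%N & J j r1.
  by apply: Jcov; apply: (le_trans (ler_normB _ _)); lra.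
have hit1 : hits A (J j1) (c (g^-1)%g (x, y)).
  by exists (h * g)%g; [rewrite hgE|rewrite /= r1E].
(* The first jump, from [g^-1 x] to [g^-1 x']: either it leaves the fiber, or a hit [h1] with
   cocycle in the same cell is found. *)
have [[h1 Ah1 /= Jh1]|nhit1] := pselect (hits A (J j1) (c (g^-1)%g (x', y)));
  last by exists j1 => //; left.
(* Travelling back from [g^-1 x'] to [x'] changes the cocycle of the hit to about [rho h x + D]. *)
pose h2 := (h1 * g^-1)%g.
have Ah2 : A (c h2 (x', y)) by rewrite actM.
pose r2 := rho h2 x'.
have r2E : r2 = rho h1 (a (g^-1)%g x') + rho (g^-1)%g x'.
  by rewrite /r2 logRN_cocycle.
have r12 := Jdiam _ _ _ Jr1 Jh1.
have r2D : `|r2 - (rho h x + D)| <= del.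
  rewrite (_ : r2 - _ = - (r1 - rho h1 (a (g^-1)%g x'))) ?normrN//.
  by rewrite r2E /r1 /D; ring.
have DC : `|D| < C.
  by rewrite /D; apply: le_lt_trans (ler_normB _ _) _; rewrite addrC.
have [j2 j2M Jr2] : exists2 j, (j < M)%N & J j r2.
  apply: Jcov; rewrite -(subrK (rho h x + D) r2).
  apply: (le_trans (ler_normD _ _)).
  have := ler_normD (rho h x) D; lra.
exists j2 => //; right; split; first by exists h2.
(* If the second jump, from [x'] to [x], succeeds too, then [h] and [h3] both send [(x, y)] into
   [A], and [k] leads from one image to the other. *)
move=> [h3 Ah3 /= Jh3].
have r23 := Jdiam _ _ _ Jr2 Jh3.
pose k := (h3 * h^-1)%g.
have phx : cocycle_point (a h x) by exact: cocycle_point_act.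
have kE : rho k (a h x) = rho h3 x - rho h x.
  have := @logRN_cocycle k h x px phx.
  by rewrite /k mulgVK => ->; rewrite addrK.
have kD : `|rho k (a h x) - D| <= 2 * del.
  rewrite kE (_ : _ - D = (r2 - (rho h x + D)) - (r2 - rho h3 x)); last by ring.
  by apply: (le_trans (ler_normB _ _)); lra.
have Dge : C^-1 <= `|D| by rewrite /D distrC.
(* Each jump costs at most [del], and [|D| >= C^-1 > 2 * del]. This is the use of the lower bound on
   cocycle differences. *)
have k1 : k != 1%g.
  apply/eqP => k1; move: kD; rewrite k1 logRN1// sub0r normrN; lra.
have Ak : A (c k (c h (x, y))).
  by rewrite -actM /k mulgVK.
have := Aret (c h (x, y)) k phx Ah k1 Ak; apply/negP; rewrite -leNgt /=.
rewrite -(subrKA D); apply: (le_trans (ler_normD _ _)).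
lra.
Qed.

(** By [hits_transfer] every [y] in the fiber is lost in one of the two jumps, for one of the [M]
    cells; a union bound concludes. *)
Lemma hits_fiber_le (A : set (X * Y)) (J : nat -> set R) (M : nat)
    (T L C del eps : R) (g : G) (x x' : X) :
  measurable A -> (forall j, measurable (J j)) ->
  (forall p h, cocycle_point p.1 -> A p -> h != 1%g -> A (c h p) ->
    eps < `|rho h p.1 - T|) ->
  (forall r, `|r| <= L + 2 * C + del -> exists2 j, (j < M)%N & J j r) ->
  (forall j r s, J j r -> J j s -> `|r - s| <= del) ->
  0 <= L -> 0 <= del -> 2 * del < C^-1 -> 4 * del <= eps ->
  cocycle_point x -> cocycle_point x' ->
  `|rho (g^-1)%g x| + `|rho (g^-1)%g x'| < C ->
  C^-1 <= `|rho (g^-1)%g x - rho (g^-1)%g x'| ->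
  `|rho (g^-1)%g x' - rho (g^-1)%g x - T| < eps / 2 ->
  (kappa (xsection (hits A [set r | (`|r| <= L)%R]) x) <=
    \sum_(j < M) fdist (hits A (J j)) (a (g^-1)%g x) (a (g^-1)%g x') +
    \sum_(j < M) fdist (hits A (J j)) x' x)%E.
Proof.
move=> mA mJ Aret Jcov Jdiam L0 del0 delC deleps px px' RC RCV RT.
pose B j := xsection (hits A (J j)).
have mL : measurable [set r : R | `|r| <= L].
  by rewrite -[X in measurable X]setTI; apply: measurable_fun_le => //;
    exact: normr_measurable.
have mB j z : measurable (B j z).
  by apply: measurable_xsection; exact: measurable_hits.
have mBD j z z' : measurable (B j z `\` B j z') by exact: measurableD.
(* The action of [g^-1] also moves [y], hence the preimage; [kappa] does not see it. *)
pose D1 j := b (g^-1)%g @^-1` (B j (a (g^-1)%g x) `\` B j (a (g^-1)%g x')).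
pose D2 j := B j x' `\` B j x.
have mD1 j : measurable (D1 j).
  by rewrite -[D1 j]setTI; exact: measurable_act.
have mbig (D : nat -> set Y) : (forall j, measurable (D j)) ->
  measurable (\big[setU/set0]_(j < M) D j).
  by move=> mD; exact: bigsetU_measurable.
apply: (@le_trans _ _ (kappa (\big[setU/set0]_(j < M) D1 j `|`
   \big[setU/set0]_(j < M) D2 j))).
  apply: le_measure; rewrite ?inE.
  - by apply: measurable_xsection; exact: measurable_hits.
  - by apply: measurableU; apply: mbig => // j; exact: mBD.
  - move=> y /xsectionP hit; rewrite -!bigcup_mkord.
    have [j jM [[h1 h2]|[h1 h2]]] :=
      hits_transfer Aret Jcov Jdiam L0 del0 delC deleps px px' RC RCV RT hit.
    + left; exists j => //; split; first exact/xsectionP.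
      by move=> /xsectionP.
    + right; exists j => //; split; first exact/xsectionP.
      by move=> /xsectionP.
apply: (le_trans (measureU2 _ _ _)); [exact: mbig|by apply: mbig => j;
  exact: mBD|].
apply: leeD.
  apply: (le_trans (Boole_inequality _ _)) => //.
  apply: lee_sum => j _.
  by rewrite -[leRHS](measure_act_preimage (g^-1)%g); last exact: mBD.
by apply: (le_trans (Boole_inequality _ _)) => // j _; exact: mBD.
Qed.

(** The fiber of [g S] over [x] is a translate of the fiber of [S] over [g^-1 x], of equal
    [kappa]-measure. A change of variables in [X] then yields the density. *)
Lemma image_product_action g (S : set (X * Y)) : measurable S ->
  ((nu \x kappa) (c g @` S) =
   \int[nu \x kappa]_(p in S) (Num.max 0 (RN a nu g p.1))%:E)%E.
Proof.
move=> mS; pose r x := (Num.max 0 (RN a nu g x))%:E.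
have r0 x : (0 <= r x)%E by rewrite lee_fin le_max lexx.
have mr : measurable_fun setT r.
  by apply/measurable_EFinP/measurable_maxr => //; exact: measurable_RN.
have mr1 : measurable_fun [set: X * Y] (fun p => r p.1).
  by apply: (@measurableT_comp _ _ _ _ _ _ r).
have mk : measurable_fun setT (fun x => kappa (xsection S x)).
  exact: measurable_fun_xsection.
rewrite image_actE.
transitivity (\int[nu]_x kappa (xsection S (a (g^-1)%g x)))%E.
  apply: eq_integral => x _ /=.
  rewrite -[RHS](@measure_act_preimage (g^-1)%g);
    last exact: measurable_xsection.
  by congr (kappa _).
have mka : measurable_fun setT (fun x => kappa (xsection S (a (g^-1)%g x))).
  exact: (measurableT_comp mk (measurable_act a _)).
rewrite (RN_change_of_variables qi g mka); last by move=> x.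
have m1 : measurable_fun setT (fun p : X * Y => (\1_S p)%:E * r p.1)%E.
  by apply: emeasurable_funM => //; apply/measurable_EFinP/measurable_indic.
rewrite [RHS]integral_mkcond.
rewrite (eq_integral (fun p => (\1_S p)%:E * r p.1)%E); last first.
  move=> p _; rewrite /patch indicE; case: ifP => _; first by rewrite mul1e.
  by rewrite mul0e.
rewrite (fubini_tonelli1 _ m1); last first.
  by move=> p; apply: mule_ge0; [rewrite lee_fin|exact: r0].
apply: ae_eq_integral => //.
- by apply: emeasurable_funM; [under eq_fun do rewrite actK|
    apply/measurable_EFinP; exact: measurable_RN].
- apply: (measurable_fun_fubini_tonelli_F _ m1).
  by move=> p; apply: mule_ge0; [rewrite lee_fin|exact: r0].
- apply: filterS (RN_gt0 qi g) => x /ltW RN0 _; rewrite actK /fubini_F /=.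
  have mi : measurable_fun setT (fun y => (\1_S (x, y) : R)%:E).
    apply/measurable_EFinP.
    exact: (measurableT_comp (measurable_indic mS) (pair1_measurable x)).
  rewrite (ge0_integralZr _ measurableT mi)//.
  rewrite /r max_r//; congr (_ * _)%E.
  rewrite -[LHS]mul1e -integral_cst//; last exact: measurable_xsection.
  rewrite integral_mkcond; apply: eq_integral => y _.
  by rewrite /patch mem_xsection indicE; case: ifP.
Qed.

Lemma quasi_invariant_product : quasi_invariant c (nu \x kappa)%E.
Proof.
have null g (S : set (X * Y)) : measurable S -> (nu \x kappa)%E S = 0%E ->
    (nu \x kappa)%E (c g @` S) = 0%E.
  move=> mS S0; rewrite image_product_action//.
  apply: (null_set_integral mS) => //; apply: measurable_funTS.
  apply/measurable_EFinP/measurable_maxr => //.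
  apply: (@measurableT_comp _ _ _ _ _ _ (RN a nu g)) => //.
  exact: measurable_RN.
move=> g S mS; split => [gS0|]; last exact: null.
have mgS : measurable (c g @` S).
  by rewrite image_actE -[X in measurable X]setTI; exact: measurable_act.
rewrite (_ : S = c (g^-1)%g @` (c g @` S)); first exact: null.
rewrite image_comp; apply/seteqP; split => [p Sp|_ [p Sp <-]].
  by exists p => //; exact: (actK c g p).
by move: Sp; rewrite -{1}(actK c g p).
Qed.

Lemma RN_product g : {ae (nu \x kappa)%E, forall p : X * Y,
  RN c (nu \x kappa)%E g p = RN a nu g p.1}.
Proof.
pose r (p : X * Y) : \bar R := (Num.max 0 (RN a nu g p.1))%:E.
have H : {ae (nu \x kappa)%E, forall p : X * Y,
    (RN c (nu \x kappa)%E g p)%:E = r p}.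
  apply: RN_unique.
  - exact: quasi_invariant_product.
  - apply/measurable_EFinP/measurable_maxr => //.
    apply: (@measurableT_comp _ _ _ _ _ _ (RN a nu g)) => //.
    exact: measurable_RN.
  - by move=> p; rewrite lee_fin le_max lexx.
  - by move=> A mA; rewrite -image_product_action.
apply: filterS2 H (ae_product_fst kappa (RN_gt0 qi g)) => p Hp p0.
by apply: EFin_inj; rewrite Hp /r max_r// ltW.
Qed.

End saturation.

(** * Weak-* limits *)

Section weak_star_mass.
Context (R : realType).
Variables (T del : R).
Hypothesis del0 : 0 < del.
Let V : set R := [set x | `|x - T| < del].
(** A test function positive exactly on [V] and at most [del]: its integral is positive when [V] has
    positive mass, and is at most [del] times that mass. *)
Let tent (x : R) : R := Num.max 0 (del - `|x - T|).

Let tent_ge0 x : 0 <= tent x.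
Proof. by rewrite /tent le_max lexx. Qed.

Let tent_continuous : continuous tent.
Proof.
move=> x; apply: (@continuous_max R _ (cst 0) (fun x => del - `|x - T|)).
  exact: cst_continuous.
apply: cvgB; first exact: cvg_cst.
apply: cvg_norm; apply: cvgB; [exact: cvg_id|exact: cvg_cst].
Qed.

Let tent_compact : compact (closure [set x | tent x != 0]).
Proof.
have subI : closure [set x | tent x != 0] `<=` `[T - del, T + del].
  rewrite [X in _ `<=` X](closure_id _).1; last exact: interval_closed.
  apply: closure_subset => x /=; rewrite /tent in_itv /= => H.
  suff : `|x - T| <= del by rewrite ler_distl.
  rewrite leNgt; apply/negP => H2; move/eqP: H; apply.
  by apply/max_idPl; rewrite subr_le0 ltW.
apply: (subclosed_compact _ (@segment_compact _ (T - del) (T + del)) subI).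
exact: closed_closure.
Qed.

Let measurable_tent : measurable_fun setT (EFin \o tent).
Proof. 
apply/measurable_EFinP; apply: continuous_measurable_fun.
exact: tent_continuous. Qed.

Lemma measurable_dist_lt : measurable V.
Proof.
rewrite (_ : V = ball T del); last first.
  by apply/seteqP; split=> x; rewrite /ball /= distrC.
exact: measurable_ball.
Qed.

Let integral_tent_gt0 (mu : {measure set R -> \bar R}) :
  (0 < mu V)%E -> (0 < \int[mu]_x (tent x)%:E)%E.
Proof.
move=> V0; rewrite lt_neqAle integral_ge0 ?andbT//; last first.
  by move=> x _; rewrite lee_fin.
apply/eqP => tent0.
have : ae_eq mu setT (EFin \o tent) (cst 0%E).
  apply/ae_eq_integral_abs => //; rewrite [RHS]tent0.
  by apply: eq_integral => x _; rewrite /= ger0_norm.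
move=> [N [mN N0 sN]]; suff VN : V `<=` N.
  have : (mu V <= mu N)%E by apply: le_measure; rewrite ?inE//;
    exact: measurable_dist_lt.
  by rewrite N0 leNgt V0.
move=> x Vx; apply: sN => /= /(_ I) /= [].
by apply/eqP; rewrite gt_eqF// /tent lt_max subr_gt0 Vx orbT.
Qed.

Let integral_tent_le (mu : {measure set R -> \bar R}) :
  (\int[mu]_x (tent x)%:E <= del%:E * mu V)%E.
Proof.
rewrite -integral_cst//; last exact: measurable_dist_lt.
rewrite [leRHS]integral_mkcond; apply: ge0_le_integral => //.
- by move=> x _; rewrite lee_fin.
- apply/(measurable_restrictT _ _).1; first exact: measurable_dist_lt.
  exact: measurable_cst.
- move=> x _; rewrite /patch; case: ifPn; rewrite ?inE ?notin_setE => Vx.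
    by rewrite lee_fin /tent ge_max ltW//= lerBlDr lerDl.
  by rewrite lee_fin /tent ge_max lexx subr_le0 leNgt; apply/negP.
Qed.

Lemma weak_star_subseq_mass (mu_ : nat -> {measure set R -> \bar R})
    (mu : {measure set R -> \bar R}) :
  weak_star_subseq_limit mu_ mu -> (0 < mu V)%E ->
  exists2 c : R, 0 < c &
    forall N, exists2 n, (N <= n)%N & (c%:E < mu_ n V)%E.
Proof.
move=> [phi phi_incr wc] /integral_tent_gt0 I0.
(* The integral may be infinite, in which case any positive [c] works. *)
have [c c0 cI] : exists2 c : R, 0 < c & (c%:E < \int[mu]_x (tent x)%:E)%E.
  move: I0; case: (\int[mu]_x _)%E => [r| |//].
    by rewrite lte_fin => r0; exists (r / 2); rewrite ?lte_fin; lra.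
  by move=> _; exists 1; rewrite ?ltry.
exists (c / del); first by rewrite divr_gt0.
move=> N.
have := wc _ tent_continuous tent_compact.
move=> /(_ _ (open_ereal_gt' cI)) [k _ /(_ (maxn k N) (leq_maxl _ _)) /= H].
have phi_ge n : (n <= phi n)%N.
  by elim: n => // n IH; apply: leq_ltn_trans IH _; exact: phi_incr.
exists (phi (maxn k N)); first exact: leq_trans (leq_maxr _ _) (phi_ge _).
have := lt_le_trans H (integral_tent_le (mu_ (phi (maxn k N)))).
by move=> cV; rewrite EFinM muleC lte_pdivrMl.
Qed.

End weak_star_mass.

(** * Covering by short intervals, choice of constants and the contradiction *)

Lemma interval_cells (R : realType) (W del : R) : 0 < del ->
  exists (J : nat -> set R) (M : nat), [/\ forall j, measurable (J j),
    forall r, `|r| <= W -> exists2 j, (j < M)%N & J j r &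
    forall j r s, J j r -> J j s -> `|r - s| <= del].
Proof.
move=> del0.
exists (fun j => `[j%:R * del - W, j.+1%:R * del - W]%classic).
exists (Num.truncn (2 * W / del)).+1; split.
- by move=> j; exact: measurable_itv.
- move=> r; rewrite ler_norml => /andP[rW Wr].
  have rW0 : 0 <= (r + W) / del by apply: divr_ge0; [lra|exact: ltW].
  exists (Num.truncn ((r + W) / del)).
    by rewrite ltnS; apply: le_truncn; rewrite ler_pM2r ?invr_gt0//; lra.
  rewrite /= in_itv /=; apply/andP; split.
    by rewrite lerBlDr -ler_pdivlMr// truncn_le.
  rewrite lerBrDr -ler_pdivrMr//; apply: ltW; exact: truncnS_gt.
- move=> j r s /=; rewrite !in_itv /= -natr1 => /andP[r1 r2] /andP[s1 s2].
  by rewrite ler_norml; apply/andP; split; lra.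
Qed.

Lemma measure_setD_null (R : realType) d (T : measurableType d)
    (mu : probability T R) (A N : set T) : measurable A -> measurable N ->
  mu N = 0%E -> mu (A `\` N) = mu A.
Proof.
move=> mA mN N0; apply/eqP; rewrite eq_le; apply/andP; split.
  by apply: le_measure; rewrite ?inE//; exact: measurableD.
apply: (@le_trans _ _ (mu (A `\` N `|` N))).
  apply: le_measure; rewrite ?inE//.
    by apply: measurableU => //; exact: measurableD.
  by move=> x Ax; have [Nx|Nx] := pselect (N x); [right|left].
apply: (le_trans (measureU2 _ _ _)) => //; first exact: measurableD.
by rewrite [X in (_ + X)%E](_ : _ = 0%E) ?adde0.
Qed.

Theorem theorem1p4 (R : realType) (d : measure_display)
    (X : measurableMetricType R d) (nu : probability X R)
    (G : groupType) (a : measurable_action G X)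
    (Upsilon : nat -> transfer_function R G X)
    (Omega : nat -> nat -> set X)
    (zetam : nat -> {measure set R -> \bar R})
    (zetalim : {measure set R -> \bar R}) :
  compact [set: X] -> is_borel X -> countable [set: G] ->
  quasi_invariant a nu -> ergodic a nu ->
  relatively_admissible a nu Upsilon Omega ->
  (forall m, weak_star_subseq_limit
    (fun n => zeta a nu (Omega n m) (Upsilon n)) (zetam m)) ->
  weak_star_subseq_limit zetam zetalim ->
  forall T : R, measure_support zetalim T ->
    stable_ratio_set a nu (expR T).
Proof.
move=> _ borelX countG qi erg.
move=> [clOmega _ close normalized [N N0 [ratio bounded]]] zetamE zetalimE T
  suppT.
move=> d' Y b kappa mp A mA A0 eps eps0; apply: contrapT => nret.
pose c := product_action a b; pose nk := (nu \x kappa)%E.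
have qip : quasi_invariant c nk by exact: quasi_invariant_product.
have mOmega n m : measurable (Omega n m).
  rewrite -[X in measurable X]setCK; apply: measurableC.
  by apply: borel_open_measurable => //; rewrite openC.
(* Continuity of the exponential passes from closeness of derivatives to [expR T] to closeness of
   logarithms to [T]. *)
have [eps1 eps10 expT] : exists2 eps1 : R, 0 < eps1 &
    forall s, `|s - T| <= eps1 -> `|expR s - expR T| <= eps.
  have /cvgrPdist_le /(_ _ eps0) := @continuous_expR R T.
  move=> /nbhs_ballP[e /= e0 He]; exists (e / 2); first by rewrite divr_gt0.
  move=> s sT; rewrite distrC; apply: He; rewrite /ball /= distrC.
  by apply: le_lt_trans sT _; rewrite ltr_pdivrMr//; lra.
have eps120 : 0 < eps1 / 2 by rewrite divr_gt0.
pose V : set R := [set x | `|x - T| < eps1 / 2].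
have V0 : (0 < zetalim V)%E.
  apply: suppT; last by rewrite /V /= subrr normr0.
  rewrite (_ : V = ball T (eps1 / 2)); first exact: ball_open.
  by apply/seteqP; split=> x; rewrite /ball /V /= distrC.
(* Any [m] at which [V] has positive mass will do; it is fixed from here on. *)
have [c0 c00 /(_ 0%N)[m _ zm]] := weak_star_subseq_mass eps120 zetalimE V0.
have zm0 : (0 < zetam m V)%E by apply: lt_trans zm; rewrite lte_fin.
pose zeta_ n : {measure set R -> \bar R} :=
  Defs_zeta__canonical__measure_function_Measure a nu (Upsilon n) (mOmega n m).
have [c1 c10 zetaV] := weak_star_subseq_mass (mu_ := zeta_)
  eps120 (zetamE m) zm0.
have [f f0 fclose] := close m.
have [C C0 ratioC] := ratio m.
have [C' C'0 boundedC'] := bounded m.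
(* For each [h], a set of positive measure returning to [A] under [h] with derivative within [eps]
   of [expR T] would contradict [nret]. Countably many null sets make up [B], and removing it from
   [A] makes the absence of returns pointwise. *)
have [B [mB B0 sB]] : {ae nk, forall (p : X * Y) h, RN c nk h p =
  RN a nu h p.1 /\
    (h != 1%g -> A p -> A (c h p) -> eps < `|RN c nk h p - expR T|)}.
  apply: (ae_forall_countable countG 1%g) => h.
  suff ret : {ae nk, forall p : X * Y, h != 1%g -> A p -> A (c h p) ->
      eps < `|RN c nk h p - expR T|}.
    by apply: filterS2 (RN_product qi mp h) ret.
  have [->|h1] := eqVneq h 1%g; first exact: nearW.
  pose S := A `&` c h @^-1` A `&` [set p | `|RN c nk h p - expR T| <= eps].
  have mS : measurable S.
    apply: measurableI.
      by apply: measurableI => //; rewrite -[X in measurable X]setTI;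
        exact: measurable_act.
    rewrite -[X in measurable X]setTI; apply: measurable_fun_le => //.
    apply: measurableT_comp; first exact: normr_measurable.
    by apply: measurable_funB => //; exact: measurable_RN.
  exists S; split => //.
    apply/eqP; rewrite eq_le measure_ge0 andbT leNgt; apply/negP => S0.
    apply: nret; exists S, h; split => //; first by move=> p [[]].
    by split => [_ [p [[_ Ahp] _] <-]//|p []].
  move=> p /= /not_implyP[_ /not_implyP[Ap /not_implyP[Ahp]]].
  by move=> /negP; rewrite -leNgt.
pose A' := A `\` B.
have mA' : measurable A' by exact: measurableD.
have A'E : nk A' = nk A by exact: (measure_setD_null mA mB B0).
have A'0 : (0 < nk A')%E by rewrite A'E.
have Aret (p : X * Y) h : cocycle_point a nu p.1 -> A' p -> h != 1%g ->
    A' (c h p) -> eps1 < `|logRN a nu h p.1 - T|.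
  move=> /(_ h)[RN0 _] [Ap Bp] h1 [Ahp _].
  have [RNE /(_ h1 Ap Ahp)] : RN c nk h p = RN a nu h p.1 /\
      (h != 1%g -> A p -> A (c h p) -> eps < `|RN c nk h p - expR T|).
    by apply: contrapT => nH; apply: Bp; apply: sB => /(_ h).
  move=> ltRN; rewrite ltNge; apply/negP => /expT.
  by rewrite /logRN lnK ?posrE// -RNE leNgt ltRN.
have c120 : 0 < c1 / 2 by rewrite divr_gt0.
(* Off [F], of measure below [c1 / 2], the fiber of hits with cocycle at most [L] in absolute value
   exceeds [theta]. *)
have [l Fl] := hits_fiber_gt countG mp erg mA' A'0 c120.
set L : R := l%:R; pose theta : R := l.+1%:R^-1.
set F := [set x | _] in Fl.
have theta0 : 0 < theta by rewrite invr_gt0.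
pose del := Num.min (C^-1 / 3) (eps1 / 4).
have del0 : 0 < del by rewrite lt_min !divr_gt0 ?invr_gt0.
have delC : 2 * del < C^-1.
  have : del <= C^-1 / 3 by rewrite ge_min lexx.
  have : 0 < C^-1 by rewrite invr_gt0.
  lra.
have deleps : 4 * del <= eps1.
  have : del <= eps1 / 4 by rewrite ge_min lexx orbT.
  lra.
have [J [M [mJ Jcov Jdiam]]] := interval_cells (L + 2 * C + del) del0.
pose H j := hits a b nu A' (J j).
have mH j : measurable (H j) by exact: measurable_hits.
(* Chosen so that the error terms add up to [theta^-1 * eta * (1 + 3 * C') = c1 / 4]; with [c1 / 2]
   from [F] the total stays below [c1]. *)
pose eta := theta * c1 / 4 / (1 + 3 * C').
have eta0 : 0 < eta.
  by rewrite !divr_gt0 ?mulr_gt0// addr_gt0// mulr_gt0.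
have [r r0 [e [me e0 ie He]]] := section_approxN M mH
  (fun j => measurable_section_approx nu kappa borelX (mH j)) eta0.
have /cvgrPdist_lt /(_ _ r0)[n1 _ fr] := f0.
(* [n] is large enough for the bounds of admissibility and for both jumps to be shorter than [r]. *)
have [n nN /ltW zn] := zetaV (maxn (N m).+1 n1).
have Nn : (N m < n)%N by apply: leq_trans nN; rewrite leq_maxl.
have fnr : f n < r.
  have := fr n; rewrite /= (leq_trans (leq_maxr _ _) nN) => /(_ isT).
  by rewrite sub0r normrN; apply: le_lt_trans; rewrite ler_norm.
have [bd1 bd2 bd3] := boundedC' n Nn.
have ratio_n := ratioC n Nn.
have mF : measurable F.
  have mhit : measurable (hits a b nu A' [set r | `|r| <= L]).
    apply: measurable_hits => //; rewrite -[X in measurable X]setTI.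
    by apply: measurable_fun_le => //; exact: normr_measurable.
  have mk : measurable_fun setT
      (fun x => kappa (xsection (hits a b nu A' [set r | `|r| <= L]) x)).
    exact: measurable_fun_xsection.
  by rewrite -[F]setTI; apply: emeasurable_fun_le.
have thetaV0 : 0 <= theta^-1 by rewrite invr_ge0 ltW.
(* Off [F] the four errors [e] add up to at least [theta], so after rescaling they dominate the
   indicator of [V]; on [F] the indicator in [q] does. *)
pose e' x := ((theta^-1)%:E * e x)%E.
have e'0 x : (0 <= e' x)%E by rewrite mule_ge0.
have me' : measurable_fun setT e' by exact: measurable_funeM.
pose q x := ((\1_F x)%:E + e' x)%E.
have q0 x : (0 <= q x)%E by rewrite adde_ge0 ?lee_fin.
have m1F : measurable_fun setT (fun x => (\1_F x : R)%:E).
  exact/measurable_EFinP/measurable_indic.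
have mq : measurable_fun setT q by exact: emeasurable_funD.
have mV : measurable V by exact: measurable_dist_lt.
have qe g : {ae (nu \x nu)%E, forall p : X * X, Omega n m p.1 ->
    0 < Upsilon n g p.1 p.2 ->
    ((\1_V (logRN a nu (g^-1)%g p.2 - logRN a nu (g^-1)%g p.1))%:E <=
    q p.1 + (e' p.2 + (e' (a (g^-1)%g p.1) + e' (a (g^-1)%g p.2))))%E}.
  have cp := ae_cocycle_point countG qi.
  apply: filterS3 (ae_product_fst nu cp) (ae_product_snd nu cp) (ratio_n g).
  move=> p px px' ratp Op U0; have [RC RCV] := ratp Op U0.
  have [p12 gp12] := fclose _ _ _ _ Op U0.
  rewrite indicE; have [Vp|] := boolP (_ \in V); last first.
    by move=> _; rewrite /= !adde_ge0.
  have [Fp|Fp] := pselect (F p.1).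
    rewrite /q indicE mem_set//= -addeA leeDl//.
    by rewrite !adde_ge0.
  rewrite /q indicE memNset// add0e /e' -!ge0_muleDr ?adde_ge0//.
  rewrite lee_pdivlMl// mule1; move/negP: Fp; rewrite -ltNge => /ltW Fp.
  apply: (le_trans Fp).
  have RT : `|logRN a nu (g^-1)%g p.2 - logRN a nu (g^-1)%g p.1 - T| < eps1 / 2.
    by move: Vp; rewrite inE.
  apply: (le_trans (hits_fiber_le countG mp mA' mJ Aret Jcov Jdiam (ler0n _ _)
    (ltW del0) delC deleps px px' RC RCV RT)).
  rewrite addeC [in leRHS]addeA; apply: leeD.
    by rewrite addeC; apply: He; rewrite metric_sym; exact: lt_trans fnr.
  by apply: He; exact: lt_trans fnr.
have := zeta_le qi countG (mOmega n m) mq q0 me' e'0 mV (ltW C'0) qe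
  (fun b => normalized n b (leq_ltn_trans (leq0n _) Nn)) bd1 bd2 bd3.
apply/negP; rewrite -ltNge; apply: lt_le_trans zn.
have ie' : (\int[nu]_x e' x <= (theta^-1 * eta)%:E)%E.
  by rewrite ge0_integralZl// EFinM lee_wpmul2l.
rewrite ge0_integralD// integral_indic// setIT.
apply: (@lt_le_trans _ _ ((c1 / 2)%:E + (theta^-1 * eta)%:E
   + (3 * C')%:E * (theta^-1 * eta)%:E)%E).
  have ie'fin : (\int[nu]_x e' x)%E \is a fin_num.
    by rewrite ge0_fin_numE ?integral_ge0// (le_lt_trans ie')// ltry.
  apply: lte_leD; [by rewrite fin_numM|exact: lte_leD|apply: lee_wpmul2l => //].
  by rewrite lee_fin mulr_ge0// ltW.
rewrite -EFinM -!EFinD lee_fin /eta.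
have -> : theta^-1 * (theta * c1 / 4 / (1 + 3 * C')) = c1 / 4 / (1 + 3 * C').
  by rewrite -!mulrA mulKf// gt_eqF.
set z := c1 / 4 / _; have : z * (1 + 3 * C') = c1 / 4.
  by rewrite /z divfK// gt_eqF//; lra.
lra.
Qed.
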